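(* Let $q$ be a power of an odd prime, let $d\ge 2$, and let $Q\in\mathbb F_q[x_1,\dots,x_d]$ be a non-degenerate quadratic form. For $E\subset\mathbb F_q^d$ and $r\in\mathbb F_q^*$ let $$W(r)=\#\Big\{(x,y,z,w)\in E^4:\ Q(z-w)\neq 0,\ \tfrac{Q(x-y)}{Q(z-w)}=r\Big\}.$$ Then: (i) If $d$ is even and $|E|\ge 4q^{d/2}$, then $W(r)\ge \frac{5|E|^4}{48q}$ for all $r\in\mathbb F_q^*$. Moreover, the threshold $d/2$ is sharp: for every such $q$ and every even $d\ge 2$ there exist $E\subset\mathbb F_q^d$ with $|E|=q^{d/2}$ and $r\in\mathbb F_q^*$ with $W(r)=0$. (ii) If $d$ is odd and $|E|\ge 3q^{d/2}$, then $W(r)\ge \frac{2|E|^4}{45q}$ for all non-zero squares $r\in\mathbb F_q^*$. Furthermore, the threshold $d/2$ cannot be lowered: for odd $d\ge 3$ there is no exponent $\gamma<d/2$ and constant $C>0$ such that for all odd prime powers $q$ and all $E\subset\mathbb F_q^d$ with $|E|\ge Cq^{\gamma}$ one has $W(r)>0$ for every non-zero square $r\in\mathbb F_q^*$. (iii) If $d$ is odd and $|E|\ge \frac{11}{6}q^{(d+1)/2}$, then $W(r)\ge \frac{2|E|^4}{363q}$ for all $r\in\mathbb F_q^*$. In addition, the threshold $(d+1)/2$ cannot be improved: for every such $q$ and every odd $d\ge 3$ there exist $E\subset\mathbb F_q^d$ with $|E|=q^{(d+1)/2}$ and $r\in\mathbb F_q^*$ with $W(r)=0$.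
   Context: A non-degenerate quadratic form is $Q(x)=x^{\top}Ax=\sum_{i,j}a_{ij}x_ix_j$ with $A$ a symmetric $d\times d$ matrix over $\mathbb F_q$ with $\det A\neq 0$. $|E|$ denotes cardinality; $\mathbb F_q^*=\mathbb F_q\setminus\{0\}$. *)

(* Defs.v *)
From Stdlib Require Import Reals.
From HB Require Import structures.
From mathcomp Require Import all_boot all_order all_algebra.
Set Implicit Arguments. Unset Strict Implicit. Unset Printing Implicit Defensive.
Import GRing.Theory.
Local Open Scope ring_scope.

Definition qform (F : fieldType) (d : nat) (A : 'M[F]_d) (x : 'rV[F]_d) : F :=
  \sum_(i < d) \sum_(j < d) A i j * x 0 i * x 0 j.

Definition nondeg (F : fieldType) (d : nat) (A : 'M[F]_d) : bool :=
  (A^T == A) && (\det A != 0).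

Definition Wcount (F : finFieldType) (d : nat) (A : 'M[F]_d)
    (E : {set 'rV[F]_d}) (r : F) : nat :=
  #|[set p : 'rV[F]_d * 'rV[F]_d * 'rV[F]_d * 'rV[F]_d |
     [&& p.1.1.1 \in E, p.1.1.2 \in E, p.1.2 \in E, p.2 \in E,
         qform A (p.1.2 - p.2) != 0 &
         qform A (p.1.1.1 - p.1.1.2) / qform A (p.1.2 - p.2) == r]]|.

Definition is_nz_square (F : fieldType) (r : F) : Prop :=
  r != 0 /\ exists s : F, r = s ^+ 2.

(* Main.v *)
Require Import Defs.
From Stdlib Require Import Reals Lra.
From HB Require Import structures.
From mathcomp Require Import all_boot all_order all_algebra.
From mathcomp Require Import all_fingroup all_field all_character.
From mathcomp Require Import ring lra zify.
Import Order.TTheory GRing.Theory Num.Theory.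
Local Open Scope ring_scope.
Set Implicit Arguments.
Unset Strict Implicit.
Unset Printing Implicit Defensive.

(** Let [q = #|F|], [n = #|E|], let [nu] be the number of pairs in [E^2] with
    [Q (x - y) = 0] and [N] the number of quadruples with
    [Q (x - y) = r * Q (z - w)]; then [W r = N - nu ^ 2].  Expand [N] and [nu]
    with a nontrivial additive character [chi].  With
    [e m = |sum_(x in E) chi (m . x)|^2 >= 0], [Q* = invmx A], and the Gauss
    sums [G t] of [Q*], completing the square gives

      [q^d (q N - n^4) = sg (q P - q^(2d) n^2)],
      [q^d (q nu - n^2) = sum_(t != 0) G (- t) sum_m e m chi (t Q* m)],

    where [P = sum e m e m'] over [Q* m = Q* m' / r], and [sg = 1] if [d] is even
    or [r] is a square, [sg = -1] otherwise.  For even [d], [G] is constant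
    [+- q^(d/2)], and the part of [P] supported on [Q* m = Q* m' = 0] compensates
    the square of the main deviation of [nu]; this is what allows the
    threshold [q^(d/2)].  For odd [d], the Fourier transform of [G] is
    [O (q^((d+1)/2))] by Parseval, which bounds [nu], and positivity of [e]
    bounds [P] from both sides.

    For sharpness of (i) and (iii), [E] is the sum of a totally isotropic subspace
    and an orthogonal line, on which [Q] takes values in [a * squares]; [r] is a
    nonsquare.  For (ii), [q = 9 ^ k] and [E] consists of the points with
    coordinates in the subfield of order [3 ^ k]. *)

(** * Additive characters of a finite field *)

Record additive_character (F : finFieldType) := AdditiveCharacter {
  achar :> F -> algC;
  acharD : forall a b, achar (a + b) = achar a * achar b;
  acharN : forall a, achar (- a) = (achar a)^*;
  achar0 : achar 0 = 1;
  achar_nontrivial : exists a, achar a != 1 }.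

(** The additive group is abelian, so its irreducible characters are linear and there are [#|F| > 1]
    of them; any one of nonzero index is nontrivial. *)
Lemma additive_character_exists (F : finFieldType) :
  inhabited (additive_character F).
Proof.
pose G := [set: F]%G.
have abG : abelian G by exact: FinRing.zmod_abelian.
have lin := char_abelianP _ abG.
have [i i0] : exists i : Iirr G, i != 0.
  apply/existsP; rewrite -[[exists _, _]]negbK negb_exists; apply/negP.
  move=> /forallP all0.
  have : (#|Iirr G| <= 1)%N.
    apply/card_le1P => x _ y; rewrite !inE.
    by move: (all0 x) (all0 y); rewrite !negbK => /eqP -> /eqP ->; rewrite eqxx.
  rewrite card_ord NirrE.
  move: abG; rewrite card_classes_abelian => /eqP ->.
  by rewrite cardsT leqNgt finNzRing_gt1.
have chi_lin := lin i.
have inG x : x \in G by rewrite inE.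
constructor; apply: (@AdditiveCharacter F (fun x => 'chi_i x)).
- by move=> a b; rewrite -(lin_charM chi_lin).
- by move=> a; rewrite -(lin_charV_conj chi_lin).
- exact: (lin_char1 chi_lin).
- apply/existsP; rewrite -[[exists _, _]]negbK negb_exists; apply/negP.
  move=> /forallP all1; case/negP: i0.
  rewrite -irr_eq1; apply/eqP/cfunP=> x; rewrite cfun1E inG.
  by apply/eqP; move: (all1 x); rewrite negbK.
Qed.

(** * Squares and nonsquares in a finite field of odd order *)

Section Squares.
Variable F : finFieldType.
Hypothesis oddF : odd #|F|.

Lemma odd_card_two_neq0 : (2%:R : F) != 0.
Proof.
apply/negP=> /eqP two0.
have ch2 : 2%N \in [pchar F] by rewrite inE /= two0 eqxx.
have q2 := card_pprimeChar ch2.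
move: oddF (finNzRing_gt1 F); rewrite q2.
by case: (logn _ _) => // n; rewrite oddX.
Qed.

Lemma odd_card_ge3 : (3 <= #|F|)%N.
Proof. by move: oddF (finNzRing_gt1 F); case: #|F| => [|[|[|]]]. Qed.

Lemma oppr_neq (y : F) : y != 0 -> - y != y.
Proof.
move=> y0; rewrite eq_sym -subr_eq0 opprK -mulr2n -mulr_natl mulf_neq0 //.
exact: odd_card_two_neq0.
Qed.

Lemma card_sqrt (y0 : F) : y0 != 0 -> #|[set y | y ^+ 2 == y0 ^+ 2]| = 2.
Proof.
move=> y0n; have -> : [set y | y ^+ 2 == y0 ^+ 2] = [set y0; - y0].
  by apply/setP=> y; rewrite !inE eqf_sqr.
by rewrite cards2 eq_sym oppr_neq.
Qed.

(** The fibre of squaring over 0 is a single point, and every other nonempty fibre is a pair [y],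
    [- y]. *)
Lemma card_squares : (#|[set x ^+ 2 | x : F]| * 2 = #|F| + 1)%N.
Proof.
pose S : {set F} := [set x ^+ 2 | x : F].
have S0 : 0 \in S by apply/imsetP; exists 0; rewrite ?expr0n.
have : (#|F| = \sum_(c in S) \sum_(x : F | x ^+ 2 == c) 1)%N.
  rewrite -[LHS]cardsT -sum1_card (partition_big_imset (fun x : F => x ^+ 2)) /=.
  have -> : [set x ^+ 2 | x in [set: F]] = S 
    by apply/setP=> c; apply/imsetP/imsetP=> -[x _ ->]; exists x; rewrite ?inE.
  apply: eq_bigr => c _; apply: eq_bigl => x; by rewrite inE.
rewrite (bigD1 0) //= (big_pred1 0) => [|x]; last by rewrite sqrf_eq0.
rewrite (eq_bigr (fun=> 2%N)) => [|c /andP[/imsetP[x _ ->]]]; last first.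
  rewrite sqrf_eq0 => x0; rewrite /= -[RHS](card_sqrt x0) -sum1_card.
  by apply: eq_bigl => y; rewrite inE.
rewrite sum_nat_const -/S.
have -> : #|[pred i in S | i != 0]| = #|S :\ 0|.
  by apply: eq_card => i; rewrite !inE andbC.
by move=> ->; rewrite (cardsD1 0 S) S0 mulnDl mul1n [RHS]addnC addnA.
Qed.

Lemma nonsquare_exists : exists r : F, ~ exists s, r = s ^+ 2.
Proof.
have [/forallP all|] := boolP [forall r : F, r \in [set x ^+ 2 | x : F]].
  have cF : #|[set x ^+ 2 | x : F]| = #|F|.
    by rewrite -cardsT; congr #|pred_of_set _|; apply/setP=> r; rewrite inE all.
  have := card_squares; have := odd_card_ge3; lia.
rewrite negb_forall => /existsP[r /negP rS]; exists r => -[s rs].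
by apply: rS; apply/imsetP; exists s.
Qed.

(** The squares and their multiples by [r] are two sets of size (q + 1) / 2 that meet at most in 0,
    so together they fill the field. *)
Lemma square_or_nonsquare_class (r c : F) : (~ exists s, r = s ^+ 2) ->
  exists y, c = y ^+ 2 \/ c = r * y ^+ 2.
Proof.
move=> rn; pose S : {set F} := [set x ^+ 2 | x : F].
have r0 : r != 0 by apply/eqP=> r0; apply: rn; exists 0; rewrite expr0n.
have cardrS : #|[set r * x | x in S]| = #|S|.
  by rewrite card_imset //; apply: mulfI.
have inter : S :&: [set r * x | x in S] \subset [set 0].
  apply/subsetP=> x; rewrite !inE => /andP[/imsetP[a _ xa] /imsetP[b /imsetP[s _ bs] xb]].
  apply/negPn/negP=> x0.
  have s0 : s != 0.
    by apply/eqP=> s0; move: x0; rewrite xb bs s0 expr0n /= mulr0 eqxx.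
  apply: rn; exists (a / s).
  by rewrite expr_div_n -xa xb bs mulfK // sqrf_eq0.
have : (#|F| <= #|S :|: [set (r * x)%R | x in S]|)%N.
  have := subset_leq_card inter; rewrite cards1.
  have := cardsUI S [set r * x | x in S]; rewrite cardrS.
  have := card_squares; rewrite -/S; lia.
rewrite -cardsT => le.
have /eqP full : S :|: [set r * x | x in S] == setT by rewrite eqEcard subsetT.
have : c \in S :|: [set r * x | x in S] by rewrite full inE.
rewrite inE => /orP[/imsetP[y _ ->]|/imsetP[b /imsetP[y _ ->] ->]].
  by exists y; left.
by exists y; right.
Qed.

(* The two sets of values have (q + 1) / 2 elements each, so they meet. *)
Lemma binary_form_universal (a b c : F) : a != 0 -> b != 0 ->
  exists x y, a * x ^+ 2 + b * y ^+ 2 = c.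
Proof.
move=> a0 b0; pose S : {set F} := [set x ^+ 2 | x : F].
pose S1 := [set a * x | x in S]; pose S2 := [set c - b * x | x in S].
have c1 : #|S1| = #|S| by rewrite card_imset //; apply: mulfI.
have c2 : #|S2| = #|S|.
  by rewrite card_imset // => x y /addrI/oppr_inj/mulfI; apply.
have : (0 < #|S1 :&: S2|)%N.
  have := cardsUI S1 S2; rewrite c1 c2.
  have : (#|S1 :|: S2| <= #|F|)%N by exact: max_card.
  have := card_squares; rewrite -/S; lia.
case/card_gt0P=> z; rewrite inE => /andP[/imsetP[_ /imsetP[x _ ->] ->]].
case/imsetP=> _ /imsetP[y _ ->] e; exists x, y; rewrite e; ring.
Qed.

(** For [c = 0] each equation has one root; otherwise exactly one of them is solvable, with two
    roots. Counting with multiplicity, [y ^+ 2] and [r * y ^+ 2] together thus cover the field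
    uniformly, which makes their character sums cancel. *)
Lemma card_sqrt_nonsquare_twist (r c : F) : (~ exists s, r = s ^+ 2) ->
  (#|[set y | y ^+ 2 == c]| + #|[set y | (r * y ^+ 2)%R == c]| = 2)%N.
Proof.
move=> rn.
have r0 : r != 0 by apply/eqP=> r0; apply: rn; exists 0; rewrite expr0n.
have [->|c0] := eqVneq c 0.
  have -> : [set y : F | y ^+ 2 == 0] = [set 0].
    by apply/setP=> y; rewrite !inE sqrf_eq0.
  have -> : [set y : F | r * y ^+ 2 == 0] = [set 0].
    by apply/setP=> y; rewrite !inE mulf_eq0 (negbTE r0) sqrf_eq0.
  by rewrite cards1.
have noboth a b : a ^+ 2 != 0 -> r * b ^+ 2 != a ^+ 2.
  move=> a0; apply/eqP=> e; apply: rn; exists (a / b).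
  have b0 : b != 0.
    by apply/eqP=> b0; move: a0; rewrite -e b0 expr0n /= mulr0 eqxx.
  by rewrite expr_div_n -e mulfK // sqrf_eq0.
have [y [cy|cy]] := square_or_nonsquare_class c rn.
  have -> : [set y | r * y ^+ 2 == c] = set0.
    by apply/setP=> z; rewrite !inE cy (negbTE (noboth _ _ _)) // -cy.
  rewrite cards0 addn0 cy card_sqrt //.
  by apply: contraNneq c0 => y0; rewrite cy y0 expr0n.
have -> : [set y | y ^+ 2 == c] = set0.
  apply/setP=> z; rewrite !inE cy; apply/negbTE; rewrite eq_sym.
  have [z0|z0] := eqVneq (z ^+ 2) 0; first by rewrite z0 -cy.
  exact: noboth.
rewrite cards0 add0n.
have y0 : y != 0 by apply: contraNneq c0 => y0; rewrite cy y0 expr0n /= mulr0.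
rewrite -[RHS](card_sqrt y0); apply: eq_card => z.
by rewrite !inE cy (inj_eq (mulfI r0)).
Qed.

End Squares.

(** * Quadratic forms over a field and splitting off a line *)

Section Forms.
Variable F : fieldType.
Implicit Types d : nat.

Definition dotp {d} (x y : 'rV[F]_d) : F := (x *m y^T) 0 0.

Lemma dotpC d (x y : 'rV[F]_d) : dotp x y = dotp y x.
Proof. by rewrite /dotp -[x in LHS]trmxK -trmx_mul mxE. Qed.

Lemma dotpDl d (x y z : 'rV[F]_d) : dotp (x + y) z = dotp x z + dotp y z.
Proof. by rewrite /dotp mulmxDl mxE. Qed.

Lemma dotpDr d (x y z : 'rV[F]_d) : dotp z (x + y) = dotp z x + dotp z y.
Proof. by rewrite dotpC dotpDl !(dotpC z). Qed.

Lemma dotpZl d a (x z : 'rV[F]_d) : dotp (a *: x) z = a * dotp x z.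
Proof. by rewrite /dotp -scalemxAl mxE. Qed.

Lemma dotpZr d a (x z : 'rV[F]_d) : dotp z (a *: x) = a * dotp z x.
Proof. by rewrite dotpC dotpZl dotpC. Qed.

Lemma dotp0l d (x : 'rV[F]_d) : dotp 0 x = 0.
Proof. by rewrite /dotp mul0mx mxE. Qed.

Lemma dotp_mull d (A : 'M[F]_d) x y : dotp (x *m A) y = dotp x (y *m A^T).
Proof. by rewrite /dotp trmx_mul trmxK mulmxA. Qed.

Lemma dotp_eq0 d (u : 'rV[F]_d) : (forall v, dotp v u = 0) -> u = 0.
Proof.
move=> u0; apply/rowP=> i; rewrite mxE -(u0 (delta_mx 0 i)).
by rewrite /dotp -rowE !mxE.
Qed.

Lemma qformE d (A : 'M[F]_d) x : qform A x = dotp (x *m A) x.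
Proof.
rewrite /qform /dotp mxE exchange_big /=; apply: eq_bigr => j _.
rewrite !mxE mulr_suml; apply: eq_bigr => i _; ring.
Qed.

Lemma qformZ d (A : 'M[F]_d) c x : qform A (c *: x) = c ^+ 2 * qform A x.
Proof. by rewrite !qformE -scalemxAl dotpZl dotpZr mulrA expr2. Qed.

Lemma qform0 d (A : 'M[F]_d) : qform A 0 = 0.
Proof. by rewrite qformE mul0mx dotp0l. Qed.

Lemma qformD d (A : 'M[F]_d) x y : A^T = A ->
  qform A (x + y) = qform A x + qform A y + 2%:R * dotp (x *m A) y.
Proof.
move=> symA; rewrite !qformE mulmxDl !dotpDl !dotpDr.
rewrite (dotp_mull A y x) symA (dotpC y); ring.
Qed.

Lemma qform_congr d d' (A : 'M[F]_d) (P : 'M[F]_(d', d)) x :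
  qform (P *m A *m P^T) x = qform A (x *m P).
Proof. by rewrite !qformE /dotp trmx_mul !mulmxA. Qed.

Lemma qform_block d d' (A : 'M[F]_d) (C : 'M[F]_d') x y :
  qform (block_mx A 0 0 C) (row_mx x y) = qform A x + qform C y.
Proof.
rewrite !qformE /dotp mul_row_block !mulmx0 addr0 add0r tr_row_mx mul_row_col.
by rewrite mxE.
Qed.

Lemma nondegP d (A : 'M[F]_d) :
  reflect (A^T = A /\ A \in unitmx) (nondeg A).
Proof.
by rewrite unitmxE unitfE; apply: (iffP andP) => -[/eqP].
Qed.

Lemma nondeg_inv d (A : 'M[F]_d) : nondeg A -> nondeg (invmx A).
Proof.
by move=> /nondegP[sA uA]; apply/nondegP; rewrite trmx_inv sA unitmx_inv.
Qed.

(** Polarization: if two basis vectors are isotropic, the value at their sum is twice the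
    corresponding entry of [A]. *)
Lemma qform_nonzero_exists d (A : 'M[F]_d) : (2%:R : F) != 0 -> A^T = A ->
  A != 0 -> exists v, qform A v != 0.
Proof.
move=> two0 sA A0.
have /existsP[i /existsP[j Aij]] : [exists i, exists j, A i j != 0].
  apply: contraNT A0 => /existsPn h.
  apply/eqP/matrixP=> i j; rewrite mxE; apply/eqP.
  by have := h i; rewrite negb_exists => /forallP/(_ j); rewrite negbK.
pose e k := delta_mx 0 k : 'rV[F]_d.
have [ei|] := eqVneq (qform A (e i)) 0; last by exists (e i).
have [ej|] := eqVneq (qform A (e j)) 0; last by exists (e j).
exists (e i + e j); rewrite qformD // ei ej !add0r mulf_neq0 //.
by rewrite /dotp -rowE trmx_delta -colE !mxE.
Qed.

(** One step of diagonalization: an anisotropic vector becomes the first basis vector, and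
    elimination clears the rest of its row and column, leaving a Schur complement. *)
Lemma nondeg_split d (A : 'M[F]_d.+1) : (2%:R : F) != 0 -> nondeg A ->
  exists (P : 'M[F]_(1 + d)) (a : F) (C : 'M[F]_d),
  [/\ P \in unitmx, a != 0, nondeg C &
      P *m (A : 'M_(1 + d)) *m P^T = block_mx a%:M 0 0 C].
Proof.
move=> two0 nA; have /nondegP[sA uA] := nA.
have A0 : A != 0.
  apply: contraTneq uA => ->; rewrite unitmxE det0 unitr0 //.
have [v Qv] := qform_nonzero_exists two0 sA A0.
(* An invertible matrix whose first row spans the line of [v]; hence the corner [a] differs from
   [qform A v] by a square factor and is nonzero. *)
pose P0 : 'M[F]_(1 + d) := row_ebase v.
have uP0 : P0 \in unitmx := row_ebase_unit v.
pose A1 : 'M[F]_(1 + d) := P0 *m (A : 'M_(1 + d)) *m P0^T.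
have sA1 : A1^T = A1 by rewrite /A1 !trmx_mul trmxK sA mulmxA.
have uA1 : A1 \in unitmx by rewrite !unitmx_mul unitmx_tr uP0 uA.
pose a := A1 0 0.
have a0 : a != 0.
  apply: contraNneq Qv => a0.
  pose w := col_ebase v *m pid_mx (\rank v) : 'rV[F]_(1 + d).
  have wE : w = (w 0 0) *: delta_mx 0 0.
    apply/rowP=> j; rewrite [RHS]mxE [X in _ = _ * X]mxE eqxx /=.
    case: (eqVneq j 0) => [->|j0]; first by rewrite mulr1.
    rewrite mulr0 /w mxE big_ord1 mxE /=.
    case: j j0 => [[|j] jlt] // _; by rewrite mulr0.
  have -> : v = w *m P0 by rewrite mulmx_ebase.
  rewrite -qform_congr -/A1 wE qformZ qformE /dotp trmx_delta -rowE -colE.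
  have -> : (col 0 (row 0 A1)) 0 0 = a by rewrite mxE mxE.
  by rewrite a0 mulr0.
pose b : 'rV[F]_d := ursubmx A1.
have A1E : A1 = block_mx a%:M b b^T (drsubmx A1).
  rewrite -[LHS]submxK; congr block_mx.
    apply/matrixP=> i j; rewrite !ord1 [RHS]mxE eqxx mulr1n.
    by rewrite [LHS]mxE [LHS]mxE !lshift0.
  by rewrite /b trmx_ursub sA1.
pose L : 'M[F]_(1 + d) := block_mx 1%:M 0 (- a^-1 *: b^T) 1%:M.
have uL : L \in unitmx by rewrite unitmxE det_lblock !det1 mulr1 unitr1.
pose C := drsubmx A1 - a^-1 *: (b^T *m b).
have LE : L *m A1 *m L^T = block_mx a%:M 0 0 C.
  rewrite A1E tr_block_mx !mulmx_block !trmx1 !trmx0.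
  rewrite !(mul1mx, mulmx1, mul0mx, mulmx0, addr0).
  rewrite linearZ /= trmxK mul_mx_scalar mul_scalar_mx -!scalemxAr -scalemxAl.
  rewrite !scalerA !mulrN mulfV // scaleN1r addNr scaleN1r addNr mul0mx.
  by rewrite scaler0 add0r addrC scaleNr.
exists (L *m P0), a, C; split=> //.
- by rewrite unitmx_mul uL.
- have uLA : L *m A1 *m L^T \in unitmx by rewrite unitmx_mul unitmx_mul unitmx_tr uL uA1.
  apply/nondegP; split.
    rewrite /C linearB /= linearZ /= trmx_mul trmxK; congr (_ - _).
    by rewrite trmx_drsub sA1.
  move: uLA; rewrite LE unitmxE det_lblock unitrM => /andP[_].
  by rewrite -unitmxE.
- by rewrite trmx_mul -LE /A1 !mulmxA.
Qed.

End Forms.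

(** * Orthogonality of characters and Gauss sums of quadratic forms *)

Lemma sum_character_eq0 (V : finZmodType) (f : V -> algC) :
  (forall x y, f (x + y) = f x * f y) -> (exists v, f v != 1) ->
  \sum_x f x = 0.
Proof.
move=> fD [v fv1].
(* Translation by [v] permutes the terms and multiplies the sum by [f v], which is not 1. *)
have /eqP : \sum_x f x = f v * \sum_x f x.
  by rewrite {1}(reindex_inj (addrI v)) big_distrr; apply: eq_bigr => x _.
rewrite -subr_eq0 -{1}[\sum_x f x]mul1r -mulrBl mulf_eq0 subr_eq0 eq_sym.
by rewrite (negbTE fv1) => /eqP.
Qed.

Section GaussSums.
Variables (F : finFieldType) (chi : additive_character F).
Hypothesis oddF : odd #|F|.
Implicit Types d : nat.

Lemma sum_chi (t : F) : \sum_a chi (a * t) = #|F|%:R *+ (t == 0).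
Proof.
have [->|t0] := eqVneq t 0.
  under eq_bigr do rewrite mulr0 achar0.
  by rewrite sumr_const.
apply: sum_character_eq0 => [x y|]; first by rewrite mulrDl acharD.
by have [a a1] := achar_nontrivial chi; exists (a / t); rewrite divfK.
Qed.

Lemma sum_chi_dotp d (u : 'rV[F]_d) :
  \sum_m chi (dotp m u) = (#|F| ^ d)%:R *+ (u == 0).
Proof.
have [->|u0] := eqVneq u 0.
  under eq_bigr do rewrite dotpC dotp0l achar0.
  by rewrite sumr_const card_mx mul1n.
apply: sum_character_eq0 => [x y|]; first by rewrite dotpDl acharD.
have [a a1] := achar_nontrivial chi.
have /existsP[v v0] : [exists v, dotp v u != 0].
  apply: contraNT u0 => /existsPn h; apply/eqP/dotp_eq0 => v.
  by apply/eqP; rewrite -[_ == _]negbK h.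
by exists ((a / dotp v u) *: v); rewrite dotpZl divfK.
Qed.

Definition gauss d (A : 'M[F]_d) (t : F) : algC := \sum_x chi (t * qform A x).

Lemma gauss_square d (A : 'M[F]_d) t u : u != 0 ->
  gauss A (u ^+ 2 * t) = gauss A t.
Proof.
move=> u0; have inj : injective (fun x : 'rV[F]_d => u *: x).
  exact: scalerI.
rewrite [RHS]/gauss (reindex_inj inj) /=; apply: eq_bigr => x _.
by rewrite qformZ mulrCA mulrA.
Qed.

Lemma gauss_conj d (A : 'M[F]_d) t : gauss A (- t) = (gauss A t)^*.
Proof.
by rewrite /gauss rmorph_sum; apply: eq_bigr => x _; rewrite mulNr acharN.
Qed.

(** Expand the product over pairs [y], [y + u]: the terms quadratic in [y] cancel, and the remaining
    linear sum over [y] vanishes unless [u = 0], since 2, [t] and [A] are invertible. *)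
Lemma gauss_mul_opp d (A : 'M[F]_d) t : nondeg A -> t != 0 ->
  gauss A t * gauss A (- t) = (#|F| ^ d)%:R.
Proof.
move=> /nondegP[sA uA] t0; rewrite mulrC big_distrlr /=.
under eq_bigr => y _.
  rewrite (reindex_inj (addrI y)) /=.
  under eq_bigr => u _ do
    rewrite qformD // -acharD mulrDr mulrDr addrA addrA mulNr addNr add0r acharD
            dotp_mull sA mulrA -dotpZr.
  over.
rewrite exchange_big /=.
under eq_bigr => u _ do rewrite -big_distrr /= sum_chi_dotp.
rewrite (bigD1 0) //= qform0 mulr0 achar0 mul1r mul0mx scaler0 eqxx mulr1n.
rewrite big1 ?addr0 // => u u0.
rewrite scaler_eq0 mulf_eq0 (negbTE t0) (negbTE (odd_card_two_neq0 oddF)) /=.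
suff /negbTE -> : u *m A != 0 by rewrite mulr0n mulr0.
by apply: contraNneq u0 => uA0; rewrite -[u](mulmxK uA) uA0 mul0mx.
Qed.

(** The Fourier transform of a Gaussian. It trades a character of [qform A] at frequency - 1 / (4 t)
    for characters of the dual form at frequency [t]. *)
Lemma gauss_complete_square d (A : 'M[F]_d) t u : nondeg A -> t != 0 ->
  \sum_m chi (t * qform (invmx A) m + dotp m u) =
  gauss (invmx A) t * chi (- (4%:R * t)^-1 * qform A u).
Proof.
move=> /nondegP[sA uA] t0.
have two0 := odd_card_two_neq0 oddF.
(* Chosen so that shifting [m] by [- c *: (u *m A)] cancels the linear term. *)
pose c := (2%:R * t)^-1.
rewrite (reindex_inj (addIr (- c *: (u *m A)))) /= /gauss big_distrl /=.
apply: eq_bigr => m _; rewrite -acharD; congr (chi _).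
have sB : (invmx A)^T = invmx A by rewrite trmx_inv sA.
rewrite qformD // qformZ dotpDl dotpZl dotpZr.
have -> : qform (invmx A) (u *m A) = qform A u.
  by rewrite !qformE mulmxK // dotpC.
have -> : dotp (m *m invmx A) (u *m A) = dotp m u.
  by rewrite dotp_mull sB mulmxK.
rewrite -qformE /c; field.
by rewrite t0 two0 (natrM _ 2 2) mulf_neq0.
Qed.

Lemma gauss_congr d (A P : 'M[F]_d) t : P \in unitmx ->
  gauss (P *m A *m P^T) t = gauss A t.
Proof.
move=> uP; rewrite [RHS]/gauss (reindex_inj (can_inj (mulmxK uP))) /=.
by apply: eq_bigr => x _; rewrite qform_congr.
Qed.

Lemma gauss_block d d' (A : 'M[F]_d) (C : 'M[F]_d') t :
  gauss (block_mx A 0 0 C) t = gauss A t * gauss C t.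
Proof.
rewrite [RHS]big_distrlr /= pair_bigA /= /gauss.
rewrite (reindex (fun p : 'rV[F]_d * 'rV[F]_d' => row_mx p.1 p.2)) /=; last first.
  exists (fun x => (lsubmx x, rsubmx x)) => [[x y] _|x _] /=.
    by rewrite row_mxKl row_mxKr.
  by rewrite hsubmxK.
by apply: eq_bigr => -[x y] _; rewrite qform_block mulrDr acharD.
Qed.

Lemma gauss_scalar1 (a t : F) :
  gauss (a%:M : 'M_1) t = \sum_(y : F) chi (t * a * y ^+ 2).
Proof.
rewrite /gauss (reindex (fun y : F => (y%:M : 'rV[F]_1))) /=; last first.
  exists (fun x : 'rV[F]_1 => x 0 0) => [y _|x _]; first by rewrite !mxE.
  by rewrite [RHS]mx11_scalar.
apply: eq_bigr => y _; congr (chi _).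
rewrite /qform !big_ord1 !mxE eqxx !mulr1n; ring.
Qed.

(** Grouped by values, the two sums add up to twice the full sum of a nontrivial character, which is
    0. *)
Lemma sum_chi_sqr_nonsquare (r t : F) : (~ exists s, r = s ^+ 2) -> t != 0 ->
  \sum_(y : F) chi (r * t * y ^+ 2) = - \sum_(y : F) chi (t * y ^+ 2).
Proof.
move=> rn t0; apply/eqP; rewrite -addr_eq0; apply/eqP.
have fib (f : F -> F) :
    \sum_(y : F) chi (t * f y) = \sum_c chi (t * c) *+ #|[set y | f y == c]|.
  rewrite (partition_big f predT) //=; apply: eq_bigr => c _.
  rewrite (eq_bigr (fun=> chi (t * c))) => [|y /eqP -> //].
  rewrite sumr_const; congr (_ *+ _); apply: eq_card => y; by rewrite !inE.
under eq_bigr do rewrite [r * t]mulrC -mulrA.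
rewrite (fib (fun y => r * y ^+ 2)) (fib (fun y => y ^+ 2)) -big_split /=.
under eq_bigr => c _ do
  rewrite -mulrnDr addnC (card_sqrt_nonsquare_twist oddF _ rn) mulrC.
by rewrite sumrMnl sum_chi (negbTE t0) mul0rn.
Qed.

(** Induction on [d] by [nondeg_split]: Gauss sums are multiplicative over orthogonal blocks, and
    each line contributes one sign. *)
Lemma gauss_nonsquare d (A : 'M[F]_d) r t : nondeg A ->
  (~ exists s, r = s ^+ 2) -> t != 0 ->
  gauss A (r * t) = (-1) ^+ d * gauss A t.
Proof.
move=> nA rn t0; elim: d A nA => [|d IH] A nA.
  rewrite expr0 mul1r; apply: eq_bigr => x _; congr (chi _).
  by rewrite /qform !big_ord0 !mulr0.
have [P [a [C [uP a0 nC eP]]]] := nondeg_split (odd_card_two_neq0 oddF) nA.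
have gE s : gauss A s = gauss (block_mx (a%:M : 'M_1) 0 0 C) s.
  by rewrite -eP (gauss_congr (A : 'M_(1 + d)) s uP).
rewrite !gE !gauss_block IH // !gauss_scalar1.
rewrite -mulrA sum_chi_sqr_nonsquare ?mulf_neq0 // exprS; ring.
Qed.

End GaussSums.

(** * Exact formulas for the counts in terms of the dual form *)

Section Counting.
Variables (F : finFieldType) (chi : additive_character F).
Hypothesis oddF : odd #|F|.
Variables (d : nat) (A : 'M[F]_d) (E : {set 'rV[F]_d}).
Hypothesis nA : nondeg A.

Notation q := (#|F|%:R : algC).
Notation n := (#|E|%:R : algC).
Notation B := (invmx A).
Notation gaussB := (gauss chi B).

Let Qd (p : 'rV[F]_d * 'rV[F]_d) : F := qform A (p.1 - p.2).
Let inEE (p : 'rV[F]_d * 'rV[F]_d) := (p.1 \in E) && (p.2 \in E).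

Definition isotropic_pairs : nat := #|[set p | inEE p && (Qd p == 0)]|.

Definition ratio_pairs (r : F) : nat :=
  #|[set P : ('rV[F]_d * 'rV[F]_d) * ('rV[F]_d * 'rV[F]_d) |
     [&& inEE P.1, inEE P.2 & Qd P.1 == r * Qd P.2]]|.

(** Clearing the denominator adds only the quadruples with [Q (z - w) = 0]; for these
    [Q (x - y) = 0] as well, so they form a square of the set of isotropic pairs. *)
Lemma Wcount_ratio_pairs r : r != 0 ->
  (Wcount A E r + isotropic_pairs ^ 2 = ratio_pairs r)%N.
Proof.
move=> r0; rewrite /ratio_pairs; set N := [set P | _].
rewrite -(cardsID [set P | Qd P.2 == 0] N) addnC; congr (_ + _)%N.
  rewrite expnS expn1 -cardsX; apply: eq_card => -[p p'].
  rewrite !inE /=; have [->|_] := eqVneq (Qd p') 0; last by rewrite !andbF.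
  by rewrite mulr0 !andbT; case: (inEE p) (inEE p') (_ == _) => [] [] [].
pose f (P : ('rV[F]_d * 'rV[F]_d) * ('rV[F]_d * 'rV[F]_d)) :=
  (P.1.1, P.1.2, P.2.1, P.2.2).
have fbij : bijective f.
  exists (fun P => ((P.1.1.1, P.1.1.2), (P.1.2, P.2))).
    by move=> [[? ?] [? ?]].
  by move=> [[[? ?] ?] ?].
rewrite /Wcount -(on_card_preimset (onW_bij _ fbij)); apply: eq_card.
move=> [[x y] [z w]]; rewrite !inE /= /inEE /Qd /=.
do 4 (case: (_ \in E); rewrite ?andbF //=).
have [->|z0] //= := eqVneq (qform A (z - w)) 0.
by rewrite (can2_eq (divfK _) (mulfK _)).
Qed.

Let ind p : algC := (inEE p)%:R.

Definition distance_sum (s : F) : algC := \sum_p ind p * chi (s * Qd p).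

Definition energy (m : 'rV[F]_d) : algC :=
  \sum_p ind p * chi (dotp m (p.1 - p.2)).

Definition energy_sum (t : F) : algC := \sum_m energy m * chi (t * qform B m).

Lemma sum_chi_pairing (I J : finType) (a : I -> algC) (b : J -> algC)
    (f : I -> F) (g : J -> F) :
  \sum_s (\sum_i a i * chi (s * f i)) * (\sum_j b j * chi (- s * g j)) =
  q * \sum_i \sum_j a i * b j *+ (f i == g j).
Proof.
under eq_bigr => s _ do rewrite big_distrlr /=.
rewrite exchange_big big_distrr /=; apply: eq_bigr => i _.
rewrite exchange_big big_distrr /=; apply: eq_bigr => j _.
under eq_bigr => s _ do rewrite mulrACA -acharD mulNr -mulrBr.
rewrite -big_distrr /= sum_chi subr_eq0.
by rewrite mulrnAr [RHS]mulrnAr mulrC.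
Qed.

Lemma sum_chi_linear (I : finType) (a : I -> algC) (f : I -> F) :
  \sum_s \sum_i a i * chi (s * f i) = q * \sum_i a i *+ (f i == 0).
Proof.
rewrite exchange_big big_distrr /=; apply: eq_bigr => i _.
by rewrite -big_distrr /= sum_chi mulrnAr [RHS]mulrnAr mulrC.
Qed.

Lemma sum_ind : \sum_p ind p = n ^+ 2.
Proof.
rewrite expr2 -natrM -cardsX -sum1_card natr_sum [RHS]big_mkcond /=.
by apply: eq_bigr => -[x y] _; rewrite /ind /inEE inE /=; case: (_ && _).
Qed.

Lemma distance_sum0 : distance_sum 0 = n ^+ 2.
Proof.
by rewrite -sum_ind; apply: eq_bigr => p _; rewrite mul0r achar0 mulr1.
Qed.

Lemma isotropic_pairsE : q * isotropic_pairs%:R = \sum_s distance_sum s.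
Proof.
rewrite sum_chi_linear /isotropic_pairs -sum1_card natr_sum big_mkcond /=.
congr (_ * _); apply: eq_bigr => p _; rewrite inE /ind.
by case: (inEE p); case: (_ == 0).
Qed.

Lemma ratio_pairsE r : q * (ratio_pairs r)%:R =
  \sum_s distance_sum s * distance_sum (- s * r).
Proof.
have -> : \sum_s distance_sum s * distance_sum (- s * r) =
  \sum_s (\sum_p ind p * chi (s * Qd p)) *
         (\sum_p ind p * chi (- s * (r * Qd p))).
  by apply: eq_bigr => s _; congr (_ * _); apply: eq_bigr => p _; rewrite mulrA.
rewrite sum_chi_pairing pair_bigA /ratio_pairs -sum1_card natr_sum big_mkcond /=.
congr (_ * _); apply: eq_bigr => -[p p'] _; rewrite inE /ind /=.
by case: (inEE p) (inEE p') (_ == _) => [] [] [];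
  rewrite ?(mulr1, mulr0, mul0r, mul0rn).
Qed.

Lemma energyE m : energy m = `|\sum_(x in E) chi (dotp m x)| ^+ 2.
Proof.
rewrite normCK rmorph_sum big_distrlr /= pair_big /= big_mkcond /=.
apply: eq_bigr => -[x y] _ /=; rewrite /ind /inEE /=.
case: ifP => _; last by rewrite mul0r.
by rewrite mul1r dotpDr acharD -acharN -[- y]scaleN1r dotpZr mulN1r.
Qed.

Lemma energy_ge0 m : 0 <= energy m.
Proof. by rewrite energyE exprn_ge0. Qed.

(** Parseval: summing over all frequencies leaves only the diagonal pairs. *)
Lemma sum_energy : \sum_m energy m = q ^+ d * n.
Proof.
rewrite exchange_big /=.
under eq_bigr => p _ do rewrite -big_distrr /= sum_chi_dotp subr_eq0 natrX.
have -> : n = \sum_x (x \in E)%:R.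
  rewrite -sum1_card natr_sum big_mkcond /=.
  by apply: eq_bigr => x _; case: (x \in E).
rewrite big_distrr /= -(pair_bigA _ (fun x y =>
   ind (x, y) * (q ^+ d *+ (x == y)))) /=.
apply: eq_bigr => x _; rewrite (bigD1 x) //= eqxx big1 => [|y yx]; last first.
  by rewrite eq_sym (negbTE yx) mulr0n mulr0.
by rewrite addr0 /ind /inEE /= andbb mulrC; case: (x \in E).
Qed.

Lemma energy_sum0 : energy_sum 0 = q ^+ d * n.
Proof.
by rewrite -sum_energy; apply: eq_bigr => m _; rewrite mul0r achar0 mulr1.
Qed.

(** The change of frequency produced by completing the square. As the inverse of 0 is 0, it is an
    injection of the whole field that fixes 0, hence usable for reindexing. *)
Let phi (t : F) := - (4%:R * t)^-1.

Lemma energy_sumE t : t != 0 -> energy_sum t = gaussB t * distance_sum (phi t).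
Proof.
move=> t0; rewrite /distance_sum big_distrr /=.
under [RHS]eq_bigr => p _ do
  rewrite mulrCA -(gauss_complete_square chi oddF _ nA t0) big_distrr /=.
rewrite exchange_big /=; apply: eq_bigr => m _.
rewrite big_distrl /=; apply: eq_bigr => p _.
by rewrite acharD mulrAC mulrA.
Qed.

Lemma distance_sum_phi t : t != 0 ->
  q ^+ d * distance_sum (phi t) = gaussB (- t) * energy_sum t.
Proof.
move=> t0; rewrite energy_sumE // mulrA [gaussB (- t) * _]mulrC.
by rewrite gauss_mul_opp ?natrX //; apply: nondeg_inv.
Qed.

Lemma phi_inj : injective phi.
Proof.
move=> x y /oppr_inj/invr_inj/mulfI; apply.
by rewrite (natrM _ 2 2) mulf_neq0 // odd_card_two_neq0.
Qed.

Lemma phi_eq0 t : (phi t == 0) = (t == 0).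
Proof.
have p0 : phi 0 = 0 by rewrite /phi mulr0 invr0 oppr0.
by rewrite -[in LHS]p0 (inj_eq phi_inj).
Qed.

Lemma qd_neq0 : q ^+ d != 0.
Proof.
rewrite -natrX pnatr_eq0 expn_eq0 negb_and -lt0n.
by rewrite (leq_trans _ (odd_card_ge3 oddF)).
Qed.

Lemma isotropic_pairs_formula :
  q ^+ d * (q * isotropic_pairs%:R - n ^+ 2) =
  \sum_(t | t != 0) gaussB (- t) * energy_sum t.
Proof.
rewrite isotropic_pairsE (bigD1 0) //= distance_sum0 addrAC subrr add0r.
rewrite (reindex_inj phi_inj) big_distrr /=; apply: eq_big => t.
  by rewrite phi_eq0.
by rewrite phi_eq0; apply: distance_sum_phi.
Qed.

Definition dual_pairs (r : F) : algC :=
  \sum_m \sum_m' energy m * energy m' *+ (qform B m == r^-1 * qform B m').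

(** The frequencies [phi t] and [- phi t * r = phi (- t / r)] carry the Gauss sums at [- t] and
    [t / r]; by the hypothesis on [sg] their product is [sg * q ^+ d] for every nonzero [t]. The
    terms at frequency 0 are the two subtracted main terms. *)
Lemma ratio_pairs_formula r (sg : algC) : r != 0 ->
  (forall t, t != 0 -> gaussB (t / r) = sg * gaussB t) ->
  q ^+ d * (q * (ratio_pairs r)%:R - n ^+ 4) =
  sg * (q * dual_pairs r - (q ^+ d * n) ^+ 2).
Proof.
(* A second factor [q ^+ d] lets [distance_sum_phi] apply to both distance sums. *)
move=> r0 hsg; apply: (mulfI qd_neq0); rewrite mulrA -expr2.
rewrite ratio_pairsE (bigD1 0) //= oppr0 mul0r distance_sum0 -exprD.
rewrite addrAC subrr add0r (reindex_inj phi_inj) big_distrr /=.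
have nB := nondeg_inv nA.
transitivity (\sum_(t | t != 0)
    q ^+ d * (sg * (energy_sum t * energy_sum (- t * r^-1)))).
  apply: eq_big => t; rewrite phi_eq0 // => t0.
  have tr0 : - t / r != 0 by rewrite mulf_neq0 ?oppr_eq0 ?invr_eq0.
  have -> : - phi t * r = phi (- t / r).
    rewrite /phi; field.
    by rewrite oppr_eq0 r0 t0 (natrM _ 2 2) mulf_neq0 // odd_card_two_neq0.
  rewrite expr2 mulrACA !distance_sum_phi // mulNr opprK hsg //.
  have := gauss_mul_opp chi oddF nB t0; rewrite natrX => <-; ring.
rewrite -big_distrr -big_distrr /=; congr (_ * (_ * _)).
have -> : q * dual_pairs r =
    \sum_t energy_sum t * energy_sum (- t * r^-1).
  rewrite -sum_chi_pairing; apply: eq_bigr => t _; congr (_ * _).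
  by apply: eq_bigr => m _; rewrite mulrA.
by rewrite [in RHS](bigD1 0) //= oppr0 mul0r energy_sum0 expr2 addrAC subrr add0r.
Qed.

Definition isotropic_energy : algC := \sum_m energy m *+ (qform B m == 0).

Lemma isotropic_energy_ge0 : 0 <= isotropic_energy.
Proof. by apply: sumr_ge0 => m _; rewrite mulrn_wge0 // energy_ge0. Qed.

Lemma isotropic_energy_le : isotropic_energy <= q ^+ d * n.
Proof.
rewrite -sum_energy; apply: ler_sum => m _; case: (_ == _) => //=.
by rewrite mulr0n energy_ge0.
Qed.

(** All terms are nonnegative, and those with both frequencies isotropic satisfy the constraint for
    any [r]. *)
Lemma dual_pairs_ge r : isotropic_energy ^+ 2 <= dual_pairs r.
Proof.
rewrite expr2 big_distrlr /=; apply: ler_sum => m _; apply: ler_sum => m' _.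
have ee : 0 <= energy m * energy m' by rewrite mulr_ge0 ?energy_ge0.
have [->|_] := eqVneq (qform B m) 0; last by rewrite mulr0n mul0r mulrn_wge0.
have [->|_] := eqVneq (qform B m') 0; first by rewrite mulr0 eqxx.
by rewrite mulr0n mulr0 mulrn_wge0.
Qed.

Lemma dual_pairs_le r : dual_pairs r <= (q ^+ d * n) ^+ 2.
Proof.
rewrite expr2 -sum_energy big_distrlr /=.
apply: ler_sum => m _; apply: ler_sum => m' _.
by case: (_ == _); rewrite // mulr0n mulr_ge0 ?energy_ge0.
Qed.

End Counting.

(** * Twisted Gauss sums and their Fourier transform in odd dimension *)

Section GaussTwists.
Variables (F : finFieldType) (chi : additive_character F).
Hypothesis oddF : odd #|F|.
Variables (d : nat) (A : 'M[F]_d).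
Hypothesis nA : nondeg A.

Notation q := (#|F|%:R : algC).

Lemma square_dec (c : F) : (exists s, c = s ^+ 2) \/ ~ (exists s, c = s ^+ 2).
Proof.
have [/existsP[s /eqP cs]|/existsP ns] := boolP [exists s, c == s ^+ 2].
  by left; exists s.
by right=> -[s cs]; apply: ns; exists s; rewrite cs.
Qed.

Lemma gauss_div_square c t : c != 0 -> (exists s, c = s ^+ 2) ->
  gauss chi A (t / c) = gauss chi A t.
Proof.
move=> c0 [s cs]; have s0 : s != 0.
  by apply: contraNneq c0 => s0; rewrite cs s0 expr0n.
by rewrite mulrC cs -exprVn gauss_square // invr_eq0.
Qed.

Lemma gauss_div_nonsquare c t : (~ exists s, c = s ^+ 2) -> t != 0 ->
  gauss chi A (t / c) = (-1) ^+ d * gauss chi A t.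
Proof.
move=> cn t0; rewrite mulrC gauss_nonsquare // => -[s cs]; apply: cn.
by exists s^-1; rewrite exprVn -cs invrK.
Qed.

Lemma gauss_div_even c t : ~~ odd d -> c != 0 -> t != 0 ->
  gauss chi A (t / c) = gauss chi A t.
Proof.
move=> ed c0 t0; have [cs|cn] := square_dec c; first exact: gauss_div_square.
by rewrite gauss_div_nonsquare // -signr_odd (negbTE ed) mul1r.
Qed.

Definition gauss_transform (c : F) : algC :=
  \sum_(t | t != 0) gauss chi A (- t) * chi (t * c).

(** Dividing [t] by a nonsquare permutes the terms and, as [d] is odd, reverses the sign of each. *)
Lemma gauss_transform0 : odd d -> gauss_transform 0 = 0.
Proof.
move=> od; have [r rn] := nonsquare_exists oddF.
have r0 : r != 0 by apply/eqP=> r0; apply: rn; exists 0; rewrite expr0n.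
have r'0 : r^-1 != 0 by rewrite invr_eq0.
have : gauss_transform 0 = - gauss_transform 0.
  rewrite {1}/gauss_transform (reindex_inj (mulIf r'0)) /= -sumrN.
  apply: eq_big => t; first by rewrite mulf_eq0 negb_or r'0 andbT.
  rewrite mulf_eq0 negb_or r'0 andbT => t0.
  rewrite -mulNr gauss_div_nonsquare ?oppr_eq0 // -signr_odd od expr1.
  by rewrite !mulr0 mulN1r mulNr.
by move/esym/eqP; rewrite eqNr => /eqP.
Qed.

(** Rescaling [t] by [c] multiplies all the Gauss sums by one common sign. *)
Lemma gauss_transform_norm c : c != 0 ->
  `|gauss_transform c| = `|gauss_transform 1|.
Proof.
move=> c0; have c'0 : c^-1 != 0 by rewrite invr_eq0.
have [sg sgE sgc] : exists2 sg : algC, `|sg| = 1 &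
    forall t, t != 0 -> gauss chi A (t / c) = sg * gauss chi A t.
  have [cs|cn] := square_dec c.
    by exists 1; rewrite ?normr1 // => t t0; rewrite mul1r gauss_div_square.
  exists ((-1) ^+ d); first by rewrite normrX normrN1 expr1n.
  by move=> t; apply: gauss_div_nonsquare.
suff -> : gauss_transform c = sg * gauss_transform 1 by rewrite normrM sgE mul1r.
rewrite /gauss_transform (reindex_inj (mulIf c'0)) big_distrr /=.
apply: eq_big => t; first by rewrite mulf_eq0 negb_or c'0 andbT.
rewrite mulf_eq0 negb_or c'0 andbT => t0.
by rewrite -mulNr sgc ?oppr_eq0 // mulfVK // mulr1 mulrA.
Qed.

Lemma gauss_transform_parseval :
  \sum_c `|gauss_transform c| ^+ 2 = q * ((q - 1) * q ^+ d).
Proof.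
pose a t : algC := if t != 0 then gauss chi A (- t) else 0.
have hE c : gauss_transform c = \sum_t a t * chi (c * t).
  rewrite /gauss_transform big_mkcond /=; apply: eq_bigr => t _.
  by rewrite /a mulrC [c * t]mulrC; case: ifP; rewrite ?mulr0 ?mul0r // mulrC.
transitivity (\sum_c (\sum_t a t * chi (c * t)) *
                     (\sum_t (a t)^* * chi (- c * t))).
  apply: eq_bigr => c _; rewrite normCK hE; congr (_ * _).
  rewrite rmorph_sum; apply: eq_bigr => t _.
  by rewrite rmorphM mulNr acharN.
rewrite sum_chi_pairing; congr (_ * _).
under eq_bigr => t _.
  rewrite (bigD1 t) //= eqxx mulr1n big1 ?addr0; last first.
    by move=> i it; rewrite eq_sym (negbTE it).
  over.
rewrite /= (bigD1 0) //= {1}/a eqxx mul0r add0r.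
rewrite (eq_bigr (fun=> q ^+ d)) => [|t t0]; last first.
  rewrite /a t0 gauss_conj conjCK mulrC -gauss_conj.
  by rewrite gauss_mul_opp // natrX.
rewrite sumr_const -[LHS]mulr_natl; congr (_ * _).
rewrite -[1 in RHS]/(1%:R) -natrB ?(leq_trans _ (odd_card_ge3 oddF)) // subn1.
by rewrite -(cardC1 (0 : F)).
Qed.

(** The [q - 1] values at nonzero [c] share one modulus, so each squared modulus is at most the
    Parseval total divided by [q - 1]. *)
Lemma gauss_transform_bound c : odd d ->
  `|gauss_transform c| ^+ 2 <= q ^+ d.+1.
Proof.
move=> od; have q3 := odd_card_ge3 oddF.
have [->|c0] := eqVneq c 0.
  by rewrite gauss_transform0 // normr0 expr0n exprn_ge0.
have q1 : 0 < q - 1 by rewrite subr_gt0 ltr1n (leq_trans _ q3).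
rewrite -(ler_pM2l q1) [q ^+ d.+1]exprS [_ * (q * _)]mulrCA -gauss_transform_parseval.
rewrite [leRHS](bigD1 0) //= -[leLHS]add0r lerD ?exprn_ge0 //.
rewrite (eq_bigr (fun=> `|gauss_transform c| ^+ 2)) => [|t t0]; last first.
  by rewrite !gauss_transform_norm.
rewrite sumr_const -[leRHS]mulr_natl ler_wpM2r ?exprn_ge0 //.
rewrite -[1]/(1%:R) -natrB ?(leq_trans _ q3) // subn1.
by rewrite -(cardC1 (0 : F)).
Qed.

End GaussTwists.

(** * Inequalities between natural numbers extracted from the formulas *)

Section Bounds.
Variable F : finFieldType.
Hypothesis oddF : odd #|F|.
Variables (d : nat) (A : 'M[F]_d) (E : {set 'rV[F]_d}).
Hypothesis nA : nondeg A.

Notation q := (#|F|%:R : algC).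
Notation n := (#|E|%:R : algC).
Notation nu := (isotropic_pairs A E).

Lemma q_gt0 : 0 < q.
Proof. by rewrite ltr0n (leq_trans _ (odd_card_ge3 oddF)). Qed.

Lemma ratio_pairs_square r : r != 0 -> (exists s, r = s ^+ 2) ->
  (#|E| ^ 4 <= #|F| * ratio_pairs A E r + #|F| ^ d * #|E| ^ 2)%N.
Proof.
move=> r0 rs; have [chi] := additive_character_exists F.
have nB := nondeg_inv nA.
have := @ratio_pairs_formula _ chi oddF _ _ E nA _ 1 r0.
rewrite mul1r => /(_ _) f; rewrite -(ler_nat algC) natrD !natrM !natrX.
have qd : 0 < q ^+ d by rewrite exprn_gt0 ?q_gt0.
rewrite -lerBlDl -(ler_pM2l qd) -subr_ge0.
set N := (ratio_pairs A E r)%:R : algC.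
have -> : q ^+ d * (q ^+ d * n ^+ 2) - q ^+ d * (n ^+ 4 - q * N) =
  q ^+ d * (q * N - n ^+ 4) + (q ^+ d * n) ^+ 2 by ring.
rewrite f => [|t t0]; last by rewrite mul1r gauss_div_square.
rewrite subrK mulr_ge0 ?(ltW q_gt0) //.
apply: le_trans (dual_pairs_ge chi A E r).
by rewrite exprn_ge0 // isotropic_energy_ge0.
Qed.

(** Here [sg = -1], so an upper bound on the dual pairs is required; the trivial one costs a factor
    [q] in the error, and this moves the threshold from d/2 to (d + 1)/2. *)
Lemma ratio_pairs_nonsquare r : odd d -> r != 0 -> ~ (exists s, r = s ^+ 2) ->
  (#|E| ^ 4 + #|F| ^ d * #|E| ^ 2 <=
   #|F| * ratio_pairs A E r + #|F| ^ d.+1 * #|E| ^ 2)%N.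
Proof.
move=> od r0 rn; have [chi] := additive_character_exists F.
have nB := nondeg_inv nA.
have f := @ratio_pairs_formula _ chi oddF _ _ E nA _ (-1) r0.
rewrite -(ler_nat algC) !natrD !natrM !natrX.
have qd : 0 < q ^+ d by rewrite exprn_gt0 ?q_gt0.
rewrite -(ler_pM2l qd) -subr_ge0.
set N := (ratio_pairs A E r)%:R : algC.
have -> : q ^+ d * (q * N + q ^+ d.+1 * n ^+ 2) -
     q ^+ d * (n ^+ 4 + q ^+ d * n ^+ 2) =
  q ^+ d * (q * N - n ^+ 4) + q * (q ^+ d * n) ^+ 2 - (q ^+ d * n) ^+ 2.
  rewrite exprS; ring.
rewrite f => [|t t0]; last first.
  by rewrite gauss_div_nonsquare // -signr_odd od expr1.
set D := dual_pairs _ _ _ _.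
have -> : -1 * (q * D - (q ^+ d * n) ^+ 2) + q * (q ^+ d * n) ^+ 2 -
   (q ^+ d * n) ^+ 2 = q * ((q ^+ d * n) ^+ 2 - D) by ring.
by rewrite mulr_ge0 ?(ltW q_gt0) // subr_ge0 dual_pairs_le.
Qed.

(** After exchanging sums, each frequency [m] carries its energy times a value of the Gauss
    transform, of modulus at most q^((d + 1)/2) = q^(k + 1); the energies sum to [q ^+ d * n]. *)
Lemma isotropic_pairs_odd k : d = k.*2.+1 ->
  (#|F| * nu <= #|E| ^ 2 + #|F| ^ k.+1 * #|E|)%N.
Proof.
move=> dE; have [chi] := additive_character_exists F.
have nB := nondeg_inv nA.
have od : odd d by rewrite dE /= odd_double.
have qd : 0 < q ^+ d by rewrite exprn_gt0 ?q_gt0.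
have f : q ^+ d * (q * nu%:R - n ^+ 2) =
    \sum_m energy chi E m * gauss_transform chi (invmx A) (qform (invmx A) m).
  rewrite (isotropic_pairs_formula chi) //.
  under eq_bigr => t _ do rewrite big_distrr /=.
  rewrite exchange_big /=; apply: eq_bigr => m _; rewrite big_distrr /=.
  by apply: eq_bigr => t _; rewrite mulrCA.
have b m : `|gauss_transform chi (invmx A) m| <= q ^+ k.+1.
  rewrite -(ler_pXn2r (ltn0Sn 1)) ?nnegrE ?exprn_ge0 ?(ltW q_gt0) //.
  apply: le_trans (gauss_transform_bound chi oddF nB m od) _.
  by rewrite dE -exprM muln2.
rewrite -(ler_nat algC) natrD !natrM !natrX -lerBlDl -(ler_pM2l qd) f.
apply: le_trans (real_ler_norm _) _.
  by rewrite -f !(rpredM, rpredB, rpredX) ?realn.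
apply: le_trans (ler_norm_sum _ _ _) _.
apply: (@le_trans _ _ (\sum_m energy chi E m * q ^+ k.+1)).
  apply: ler_sum => m _; rewrite normrM ger0_norm ?energy_ge0 //.
  by rewrite ler_wpM2l ?energy_ge0.
by rewrite -big_distrl /= sum_energy mulrAC -mulrA.
Qed.

End Bounds.

(** * Lower bounds for [Wcount], first in even and then in odd dimension *)

Lemma even_main_bounds (F : finFieldType) (m : nat) (A : 'M[F]_m.*2)
    (E : {set 'rV[F]_m.*2}) (r : F) : odd #|F| -> nondeg A -> r != 0 ->
  exists b : bool,
  let T : int := (-1) ^+ b *
      (#|F|%:Z * (isotropic_pairs A E)%:Z - #|E|%:Z ^+ 2) +
    #|F|%:Z ^+ m * #|E|%:Z in
  [/\ 0 <= T, T <= #|F|%:Z * #|F|%:Z ^+ m * #|E|%:Z &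
   #|F|%:Z * #|E|%:Z ^+ 4 + T ^+ 2 -
     #|F|%:Z * (#|F|%:Z ^+ m) ^+ 2 * #|E|%:Z ^+ 2 <=
   #|F|%:Z ^+ 2 * (ratio_pairs A E r)%:Z].
Proof.
move=> oddF nA r0; have [chi] := additive_character_exists F.
set q : algC := #|F|%:R; set n : algC := #|E|%:R.
set nu := isotropic_pairs A E; set N := ratio_pairs A E r.
pose g := gauss chi (invmx A).
have nB := nondeg_inv nA.
have ed : ~~ odd m.*2 by rewrite odd_double.
have q0 : 0 < q := q_gt0 oddF.
have gE t : t != 0 -> g t = g 1.
  by move=> t0; rewrite /g -(gauss_div_even chi oddF nB ed t0 t0) divff.
(* Since [g] is constant on nonzero arguments, [gauss_mul_opp] determines its square. *)
have [b gb] : exists b : bool, g 1 = (-1) ^+ b * q ^+ m.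
  have /eqP : g 1 ^+ 2 = (q ^+ m) ^+ 2.
    rewrite expr2 -{2}(gE (-1)) ?oppr_eq0 ?oner_eq0 //.
    by rewrite gauss_mul_opp ?oner_eq0 // natrX -exprM muln2.
  rewrite eqf_sqr => /orP[]/eqP ->; first by exists false; rewrite mul1r.
  by exists true; rewrite expr1 mulN1r.
exists b => T.
pose M0 := isotropic_energy chi A E.
pose Tc : algC := (-1) ^+ b * (q * nu%:R - n ^+ 2) + q ^+ m * n.
have TE : T%:~R = Tc.
  by rewrite rmorphD !rmorphM rmorphB rmorphM !rmorphXn rmorphN1.
have qm : 0 < q ^+ m by rewrite exprn_gt0.
have q2m : q ^+ m.*2 = q ^+ m * q ^+ m by rewrite -exprD addnn.
(* The summand [q ^+ m * n] of [T] supplies the missing [t = 0] term; the completed sum over [t]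
   selects the isotropic frequencies. So [T] is the isotropic energy rescaled, whence its two
   bounds. *)
have key : q ^+ m * Tc = q * M0.
  have := isotropic_pairs_formula chi oddF E nA; rewrite -/q -/n -/nu.
  rewrite (eq_bigr (fun t => g 1 * energy_sum chi A E t)); last first.
    by move=> t t0; rewrite -(gE (- t)) ?oppr_eq0.
  rewrite -big_distrr /= => f.
  have s0 : \sum_t energy_sum chi A E t = q * M0 by exact: sum_chi_linear.
  move: s0; rewrite (bigD1 0) //= energy_sum0 => s0.
  move: f; rewrite gb q2m => f; rewrite -s0 -/q -/n q2m /Tc.
  have qmn : q ^+ m != 0 by rewrite gt_eqF.
  apply: (mulfI qmn).
  have sg2 : (-1) ^+ b * (-1) ^+ b = 1 :> algC by rewrite -expr2 sqrr_sign.
  transitivity ((-1) ^+ b * (q ^+ m * q ^+ m * (q * nu%:R - n ^+ 2)) +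
      q ^+ m * q ^+ m * (q ^+ m * n)); first by ring.
  rewrite f.
  transitivity (((-1) ^+ b * (-1) ^+ b) * q ^+ m *
     (\sum_(t | t != 0) energy_sum chi A E t) + q ^+ m * q ^+ m * (q ^+ m * n)).
    by ring.
  rewrite sg2; ring.
have M0ge : 0 <= M0 by exact: isotropic_energy_ge0.
have M0le : M0 <= q ^+ m * q ^+ m * n.
  by rewrite -q2m; exact: isotropic_energy_le.
split.
- rewrite -(ler_int algC) TE -(pmulr_rge0 _ qm) key.
  by rewrite mulr_ge0 // ltW.
- rewrite -(ler_int algC) TE -(ler_pM2l qm) key !rmorphM rmorphXn /=.
  rewrite -/q -/n.
  have -> : q ^+ m * (q * q ^+ m * n) = q * (q ^+ m * q ^+ m * n) by ring.
  by rewrite ler_pM2l.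
- rewrite -(ler_int algC) rmorphB rmorphD !rmorphM !rmorphXn /= TE -/q -/n -/N.
  have := @ratio_pairs_formula _ chi oddF _ _ E nA _ 1 r0.
  rewrite -/q -/n -/N mul1r => f.
  rewrite -subr_ge0.
  (* The bound of the dual pairs by the squared isotropic energy becomes, through [key], the term
     [T ^+ 2]. *)
  have := dual_pairs_ge chi A E r; rewrite -/M0; set P := dual_pairs _ _ _ _ in f *.
  move=> Pge.
  have qq : 0 < q ^+ m * q ^+ m by rewrite mulr_gt0.
  rewrite -(pmulr_rge0 _ qq).
  have -> : q ^+ m * q ^+ m * (q ^+ 2 * N%:~R -
      (q * n ^+ 4 + Tc ^+ 2 - q * (q ^+ m) ^+ 2 * n ^+ 2)) =
      q * (q ^+ m * q ^+ m * (q * N%:R - n ^+ 4)) - (q ^+ m * Tc) ^+ 2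
      + q * (q ^+ m * q ^+ m * n) ^+ 2.
    by ring.
  rewrite -q2m f; last first.
    by move=> t t0; rewrite mul1r gauss_div_even.
  have -> : q * (q * P - (q ^+ m.*2 * n) ^+ 2) - (q ^+ m * Tc) ^+ 2 +
     q * (q ^+ m.*2 * n) ^+ 2 = q * (q * P) - (q ^+ m * Tc) ^+ 2 by ring.
  rewrite key exprMn mulrA -expr2 -mulrBr mulr_ge0 ?subr_ge0 //.
  by rewrite exprn_ge0 // ltW.
Qed.


(** With [X] = q^(d/2), the term [T ^+ 2] cancels against the one in [(q * nu) ^+ 2], leaving an
    expression linear in [T]. For [s = 1] the upper bound on [T] gives
    [(q - 1) * n ^+ 2 * (n - X) ^+ 2]; for [s = -1] the lower bound 0 is used. As [q] is at least 3,
    the constants reached are 3/8 and 5/12, both above 5/48. *)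
Lemma even_arith (q n nu N W X s : int) : 3%:R <= q -> 0 <= X ->
  4%:R * X <= n -> W + nu ^+ 2 = N -> s = 1 \/ s = -1 ->
  let T := s * (q * nu - n ^+ 2) + X * n in
  0 <= T -> T <= q * X * n ->
  q * n ^+ 4 + T ^+ 2 - q * X ^+ 2 * n ^+ 2 <= q ^+ 2 * N ->
  5%:R * n ^+ 4 <= 48%:R * (q * W).
Proof.
move=> q3 X0 nX WN sE T T0 T1 hN.
have q0 : 0 < q by lra.
have n0 : 0 <= n by lra.
have n2 : 0 <= n ^+ 2 by rewrite exprn_ge0.
have n4 : 0 <= n ^+ 4 by rewrite exprn_ge0.
have nX0 : 0 <= n - X by lra.
rewrite -(ler_pM2l q0).
have hq : q * (48%:R * (q * W)) = 48%:R * (q ^+ 2 * N - (q * nu) ^+ 2).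
  by rewrite -WN; ring.
rewrite hq; case: sE => sE.
  have nuE : q * nu = n ^+ 2 - X * n + T by rewrite /T sE; ring.
  have sq : 9%:R * n ^+ 2 <= 16%:R * (n - X) ^+ 2.
    have : 3%:R * n <= 4%:R * (n - X) by lra.
    move=> h; have : (3%:R * n) ^+ 2 <= (4%:R * (n - X)) ^+ 2.
      by rewrite ler_pXn2r // nnegrE ?mulr_ge0.
    by rewrite !exprMn.
  have step : n ^+ 2 * (n - X) ^+ 2 * (q - 1) <= q ^+ 2 * N - (q * nu) ^+ 2.
    have : 0 <= n * (n - X) * (q * X * n - T).
      by rewrite !mulr_ge0 // subr_ge0.
    rewrite nuE; move: hN; clearbody T; nra.
  have s1 : 9%:R * n ^+ 4 * (q - 1) <= 16%:R * (n ^+ 2 * (n - X) ^+ 2 * (q - 1)).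
    have : 0 <= (n ^+ 2 * (q - 1)) * (16%:R * (n - X) ^+ 2 - 9%:R * n ^+ 2).
      by rewrite mulr_ge0 ?subr_ge0 // mulr_ge0 //; lra.
    by nra.
  have s2 : 0 <= n ^+ 4 * (q - 3%:R) by rewrite mulr_ge0 // subr_ge0.
  by lra.
have nuE : q * nu = n ^+ 2 + X * n - T by rewrite /T sE; ring.
have sq : 16%:R * (n + X) ^+ 2 <= 25%:R * n ^+ 2.
  have : 4%:R * (n + X) <= 5%:R * n by lra.
  move=> h; have : (4%:R * (n + X)) ^+ 2 <= (5%:R * n) ^+ 2.
    by rewrite ler_pXn2r // nnegrE ?mulr_ge0 // addr_ge0.
  by rewrite !exprMn.
have sX : 16%:R * X ^+ 2 <= n ^+ 2.
  have : (4%:R * X) ^+ 2 <= n ^+ 2 by rewrite ler_pXn2r // nnegrE ?mulr_ge0.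
  by rewrite exprMn.
have step : q * n ^+ 4 - q * X ^+ 2 * n ^+ 2 - n ^+ 2 * (n + X) ^+ 2 <=
    q ^+ 2 * N - (q * nu) ^+ 2.
  have : 0 <= n * (n + X) * T by rewrite !mulr_ge0 // addr_ge0.
  rewrite nuE; move: hN; clearbody T; nra.
have s1 : 0 <= q * n ^+ 2 * (n ^+ 2 - 16%:R * X ^+ 2).
  by rewrite !mulr_ge0 ?subr_ge0 // ltW.
have s2 : 0 <= n ^+ 2 * (25%:R * n ^+ 2 - 16%:R * (n + X) ^+ 2).
  by rewrite mulr_ge0 ?subr_ge0.
have s3 : 0 <= n ^+ 4 * (q - 3%:R) by rewrite mulr_ge0 // subr_ge0.
by nra.
Qed.

Lemma even_lower_bound (F : finFieldType) (d : nat) (A : 'M[F]_d)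
    (E : {set 'rV[F]_d}) : odd #|F| -> ~~ odd d -> nondeg A ->
  (4 * #|F| ^ d./2 <= #|E|)%N ->
  forall r : F, r != 0 -> (5 * #|E| ^ 4 <= 48 * #|F| * Wcount A E r)%N.
Proof.
move=> oddF ed; have := even_halfK ed; move: (d./2) => m dm.
move: A E; rewrite -{}dm => A E nA hE r r0.
have WN := Wcount_ratio_pairs A E r0.
have [b [T0 T1 hN]] := even_main_bounds E oddF nA r0.
have q3 := odd_card_ge3 oddF.
have XE : #|F|%:Z ^+ m = (#|F| ^ m)%:Z by rewrite -[RHS]natz natrX natz.
have sE : (-1) ^+ b = 1 :> int \/ (-1) ^+ b = -1 :> int.
  by case: (b); [right|left].
rewrite -(ler_nat int) -mulnA natrM natrX !natrM !natz.
apply: even_arith sE T0 T1 hN; rewrite -?PoszM -?PoszD ?XE -?PoszM; first by lia.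
- by [].
- by rewrite lez_nat.
- by rewrite -WN; lia.
Qed.

(** Here q^d = [q * X ^+ 2]. The losses relative to [q * n ^+ 4] are 1/9 from [N], and 1/3, 2/5 and
    1/9 from expanding [(n + q * X) ^+ 2]; what remains is 2/45. *)
Lemma odd_square_arith (q n nu N W X : int) : 3%:R <= q -> 0 <= X -> 0 <= n ->
  9%:R * (q * X ^+ 2) <= n ^+ 2 -> W + nu ^+ 2 = N -> 0 <= nu ->
  q * nu <= n ^+ 2 + q * X * n ->
  n ^+ 4 <= q * N + q * X ^+ 2 * n ^+ 2 ->
  2%:R * n ^+ 4 <= 45%:R * (q * W).
Proof.
move=> q3 X0 n0 nX WN nu0 hnu hN.
have q0 : 0 < q by lra.
have n2 : 0 <= n ^+ 2 by rewrite exprn_ge0.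
have n4 : 0 <= n ^+ 4 by rewrite exprn_ge0.
rewrite -(ler_pM2l q0).
have -> : q * (45%:R * (q * W)) = 45%:R * (q * (q * N) - (q * nu) ^+ 2).
  by rewrite -WN; ring.
(* From 25 <= 27 <= 9 q; this bounds the cross term. *)
have X5 : 5%:R * X <= n.
  rewrite -(ler_pXn2r (ltn0Sn 1)) ?nnegrE ?mulr_ge0 //.
  have X2 : 0 <= X ^+ 2 by rewrite exprn_ge0.
  rewrite exprMn; have : 0 <= (q - 3%:R) * X ^+ 2 by rewrite mulr_ge0 // subr_ge0.
  by lra.
have h1 : (q * nu) ^+ 2 <= n ^+ 2 * (n + q * X) ^+ 2.
  rewrite -exprMn; have -> : n * (n + q * X) = n ^+ 2 + q * X * n by ring.
  rewrite ler_pXn2r // nnegrE ?mulr_ge0 // ?addr_ge0 ?mulr_ge0 //; exact: ltW.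
have h2 : 0 <= q * (q * N + q * X ^+ 2 * n ^+ 2 - n ^+ 4).
  by rewrite mulr_ge0 ?subr_ge0 // ltW.
have h3 : 0 <= q * n ^+ 2 * (n ^+ 2 - 9%:R * (q * X ^+ 2)).
  by rewrite !mulr_ge0 ?subr_ge0 // ltW.
have h4 : 0 <= q * n ^+ 3 * (n - 5%:R * X).
  by rewrite !mulr_ge0 ?subr_ge0 ?exprn_ge0 // ltW.
have h5 : 0 <= n ^+ 4 * (q - 3%:R) by rewrite mulr_ge0 // subr_ge0.
by nra.
Qed.

(** With [Y = q * X], at most 6/11 of [n], one has Y^2 <= (36/121) n^2 and (n + Y)^2 <= (289/121)
    n^2. The remaining factor (85 q - 253)/121 is at least 2 q / 363 because [q] is at least 3. *)
Lemma odd_general_arith (q n nu N W X : int) : 3%:R <= q -> 0 <= X -> 0 <= n ->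
  11%:R * (q * X) <= 6%:R * n -> W + nu ^+ 2 = N -> 0 <= nu ->
  q * nu <= n ^+ 2 + q * X * n ->
  n ^+ 4 + q * X ^+ 2 * n ^+ 2 <= q * N + (q * X) ^+ 2 * n ^+ 2 ->
  2%:R * n ^+ 4 <= 363%:R * (q * W).
Proof.
move=> q3 X0 n0; have q0 : 0 < q by lra.
move=> nX WN nu0 hnu hN.
have n2 : 0 <= n ^+ 2 by rewrite exprn_ge0.
have n4 : 0 <= n ^+ 4 by rewrite exprn_ge0.
rewrite -(ler_pM2l q0).
have -> : q * (363%:R * (q * W)) = 363%:R * (q * (q * N) - (q * nu) ^+ 2).
  by rewrite -WN; ring.
have h2 : 0 <= q * (q * N + (q * X) ^+ 2 * n ^+ 2 - (n ^+ 4 + q * X ^+ 2 * n ^+ 2)).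
  by rewrite mulr_ge0 ?subr_ge0 // ltW.
have : q * (q * X ^+ 2 * n ^+ 2) = (q * X) ^+ 2 * n ^+ 2 by ring.
have : 0 <= q * X by rewrite mulr_ge0 // ltW.
rewrite mulrBr mulrDr mulrDr in h2; move: h2 hnu nX.
move: (q * X) => Y h2 hnu nY Y0 YE; rewrite YE in h2.
have h1 : (q * nu) ^+ 2 <= n ^+ 2 * (n + Y) ^+ 2.
  rewrite -exprMn; have -> : n * (n + Y) = n ^+ 2 + Y * n by ring.
  by rewrite ler_pXn2r // nnegrE ?addr_ge0 ?mulr_ge0 // ltW.
have h3 : 0 <= (q - 1) * n ^+ 2 * (36%:R * n ^+ 2 - 121%:R * Y ^+ 2).
  rewrite !mulr_ge0 //; first by lra.
  have : (11%:R * Y) ^+ 2 <= (6%:R * n) ^+ 2.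
    by rewrite ler_pXn2r // nnegrE ?mulr_ge0.
  by rewrite !exprMn -subr_ge0.
have h4 : 0 <= n ^+ 2 * (289%:R * n ^+ 2 - 121%:R * (n + Y) ^+ 2).
  rewrite mulr_ge0 //.
  have : (11%:R * (n + Y)) ^+ 2 <= (17%:R * n) ^+ 2.
    rewrite ler_pXn2r // ?nnegrE ?mulr_ge0 ?addr_ge0 //; lra.
  by rewrite !exprMn -subr_ge0.
have h5 : 0 <= n ^+ 4 * (q - 3%:R) by rewrite mulr_ge0 // subr_ge0.
by nra.
Qed.

Lemma odd_square_lower_bound (F : finFieldType) (d : nat) (A : 'M[F]_d)
    (E : {set 'rV[F]_d}) : odd #|F| -> odd d -> nondeg A ->
  (9 * #|F| ^ d <= #|E| ^ 2)%N ->
  forall r : F, is_nz_square r -> (2 * #|E| ^ 4 <= 45 * #|F| * Wcount A E r)%N.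
Proof.
move=> oddF od nA hE r [r0 rs].
have dE : d = d./2.*2.+1 by rewrite -[LHS]odd_double_half od.
have qd : (#|F| ^ d = #|F| * (#|F| ^ d./2) ^ 2)%N.
  by rewrite {1}dE expnS -muln2 expnM.
have WN := Wcount_ratio_pairs A E r0.
have hN := ratio_pairs_square oddF E nA r0 rs.
have hnu := isotropic_pairs_odd oddF E nA dE.
have q3 := odd_card_ge3 oddF.
rewrite -(ler_nat int) -mulnA natrM natrX !natrM !natz.
rewrite qd in hE hN; rewrite (expnS _ d./2) in hnu.
move: (#|F| ^ _)%N hE hN hnu => X hE hN hnu.
by apply: (@odd_square_arith _ _ (isotropic_pairs A E) (ratio_pairs A E r) _ X); lia.
Qed.

Lemma odd_lower_bound (F : finFieldType) (d : nat) (A : 'M[F]_d)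
    (E : {set 'rV[F]_d}) : odd #|F| -> odd d -> nondeg A ->
  (11 * #|F| ^ (d.+1)./2 <= 6 * #|E|)%N ->
  forall r : F, r != 0 -> (2 * #|E| ^ 4 <= 363 * #|F| * Wcount A E r)%N.
Proof.
move=> oddF od nA hE r r0.
have dE : d = d./2.*2.+1 by rewrite -[LHS]odd_double_half od.
have qd : (#|F| ^ d = #|F| * (#|F| ^ d./2) ^ 2)%N.
  by rewrite {1}dE expnS -muln2 expnM.
have dh : (d.+1)./2 = (d./2).+1 by rewrite {1}dE -[_.+2]/(_.+1.*2) doubleK.
rewrite dh expnS in hE.
have WN := Wcount_ratio_pairs A E r0.
have q3 := odd_card_ge3 oddF.
have hN : (#|E| ^ 4 + #|F| ^ d * #|E| ^ 2 <=
   #|F| * ratio_pairs A E r + #|F| ^ d.+1 * #|E| ^ 2)%N.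
  (* For a square [r] the sharper estimate implies this one, as 2 <= q. *)
  have [rs|rn] := square_dec r; last exact: ratio_pairs_nonsquare.
  have := ratio_pairs_square oddF E nA r0 rs; rewrite (expnS _ d).
  move: (_ ^ d)%N (_ ^ 4)%N (_ ^ 2)%N (ratio_pairs _ _ _) => a b c e; nia.
have hnu := isotropic_pairs_odd oddF E nA dE.
rewrite -(ler_nat int) -mulnA natrM natrX !natrM !natz.
rewrite (expnS _ d) qd in hN; rewrite (expnS _ d./2) in hnu.
move: (#|F| ^ _)%N hE hN hnu => X hE hN hnu.
by apply: (@odd_general_arith _ _ (isotropic_pairs A E) (ratio_pairs A E r) _ X); lia.
Qed.

(** * Isotropic subspaces and sharpness of (i) and (iii) *)

Lemma kernel_vector_exists (F : fieldType) (n k : nat) (M : 'M[F]_(n, k)) :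
  (k < n)%N -> exists2 v : 'rV[F]_n, v != 0 & v *m M = 0.
Proof.
move=> kn; have : kermx M != 0.
  rewrite -mxrank_eq0 mxrank_ker -lt0n subn_gt0.
  exact: leq_ltn_trans (rank_leq_col M) kn.
case/rowV0Pn=> v vK v0; exists v => //.
by apply/sub_kermxP.
Qed.

Lemma sub_row_free_exists (F : fieldType) (m n k : nat) (M : 'M[F]_(m, n)) :
  (k <= \rank M)%N ->
  exists2 C : 'M[F]_(k, n), row_free C & (C <= M)%MS.
Proof.
move=> kM; exists (pid_mx k *m row_base M); last first.
  by rewrite (submx_trans (submxMl _ _)) ?eq_row_base.
rewrite /row_free mxrankMfree ?row_base_free //.
by rewrite rank_pid_mx.
Qed.

(** Choose nonzero pairwise orthogonal [e], [f], [g]. If none is isotropic, the binary form on the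
    span of [e] and [f] represents [- qform A g]. *)
Lemma isotropic_vector_exists (F : finFieldType) (d : nat) (A : 'M[F]_d) :
  odd #|F| -> (2 < d)%N -> A^T = A -> exists2 v : 'rV[F]_d, v != 0 & qform A v = 0.
Proof.
move=> oddF d3 sA.
have orth u w (h : w *m (A *m u^T) = 0) : dotp (u *m A) w = 0.
  by rewrite dotp_mull sA dotpC /dotp -mulmxA h mxE.
have [e e0 _] := @kernel_vector_exists F d 0 0 (ltnW (ltnW d3)).
have [Qe|Qe] := eqVneq (qform A e) 0; first by exists e.
have [f f0 /orth fe] := kernel_vector_exists (A *m e^T) (ltnW d3).
have [Qf|Qf] := eqVneq (qform A f) 0; first by exists f.
have [g g0] := kernel_vector_exists (row_mx (A *m e^T) (A *m f^T)) d3.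
rewrite mul_mx_row -[0]row_mx0 => /eq_row_mx[/orth ge /orth gf].
have [Qg|Qg] := eqVneq (qform A g) 0; first by exists g.
have [x [y xy]] := binary_form_universal oddF (- qform A g) Qe Qf.
exists (x *: e + y *: f + g).
  (* The vector is nonzero because its pairing with [g] is [qform A g]. *)
  apply: contraNneq Qg => v0; have := dotp0l g; rewrite -{1}(mul0mx _ A) -v0.
  rewrite !mulmxDl -!scalemxAl !dotpDl !dotpZl ge gf !mulr0 !add0r -qformE.
  by move=> ->.
rewrite !qformD // !qformZ mulmxDl -!scalemxAl !dotpDl !dotpZl dotpZr ge gf fe.
by rewrite !mulr0 !addr0 mulr0 addr0 -[x ^+ 2 * _]mulrC -[y ^+ 2 * _]mulrC xy addNr.
Qed.

(* A totally isotropic subspace together with one more orthogonal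
   line: on their sum the form depends on a single coordinate. *)
Lemma rank_one_subspace_exists (F : finFieldType) (d : nat) (A : 'M[F]_d) :
  odd #|F| -> A^T = A ->
  exists2 B : 'M[F]_((d.+1)./2, d), row_free B &
  exists a : F, forall x, exists l : F, qform A (x *m B) = a * l ^+ 2.
Proof.
move=> oddF; elim/ltn_ind: d A => -[|[|[|d]]] IH A sA.
- exists 0; first by rewrite /row_free mxrank0.
  by exists 0 => x; exists 0; rewrite mulmx0 qform0 mul0r.
- exists 1%:M; first by rewrite /row_free mxrank1.
  exists (A 0 0) => x; exists (x 0 0).
  by rewrite /qform !big_ord1 mulmx1 expr2 mulrA.
- exists (delta_mx 0 0); first by rewrite /row_free mxrank_delta.
  exists (qform A (delta_mx 0 0)) => x; exists (x 0 0).
  rewrite [x in x *m _]mx11_scalar mul_scalar_mx qformZ mulrC.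
  by congr (qform A _ * _); apply/matrixP => i j; rewrite !mxE.
have [v v0 Qv] := isotropic_vector_exists oddF (isT : (2 < d.+3)%N) sA.
(* The hyperplane orthogonal to [v] contains [v]; a complement of [v] inside it has dimension two
   less than the space, and the induction applies there. *)
pose K := kermx (A *m v^T).
have vr : \rank v = 1%N by rewrite rank_rV v0.
have vK : (v <= K)%MS.
  apply/sub_kermxP; apply/matrixP=> i j; rewrite !ord1 mulmxA [RHS]mxE -Qv.
  by rewrite qformE.
have Kr : (d.+1 <= \rank (K :\: v)%MS)%N.
  have := mxrank_cap_compl K v.
  have := mxrankS (capmxSr K v); rewrite vr.
  have : (d.+2 <= \rank K)%N.
    rewrite mxrank_ker; have := rank_leq_col (A *m v^T); lia.
  lia.
have [C fC CK] := sub_row_free_exists Kr.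
have sC : (C *m A *m C^T)^T = C *m A *m C^T.
  by rewrite !trmx_mul trmxK sA mulmxA.
have [B' fB' [a ha]] := IH d.+1 (ltnW (ltnSn _)) _ sC.
have B'K : (B' *m C <= K :\: v)%MS := submx_trans (submxMl _ _) CK.
exists (col_mx v (B' *m C)).
  have rE : \rank (col_mx v (B' *m C)) = \rank (v + B' *m C)%MS.
    by rewrite addsmxE.
  rewrite /row_free rE mxrank_disjoint_sum; last first.
    apply/eqP; rewrite -submx0 -(capmx_diff K v) capmxC.
    by rewrite capmxS // ?B'K.
  by rewrite vr mxrankMfree // (eqP fB').
exists a => x; pose x' : 'rV[F]_(1 + (d.+2)./2) := x.
pose y := lsubmx x'; pose z := rsubmx x'.
have [l hl] := ha z; exists l; rewrite -hl.
have -> : x *m col_mx v (B' *m C) = y *m v + z *m (B' *m C).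
  by rewrite -mul_row_col hsubmxK.
(* As [v] is isotropic and orthogonal to [K], its component does not affect the form. *)
rewrite [y]mx11_scalar mul_scalar_mx qformD // qformZ Qv mulr0 add0r.
rewrite qform_congr -mulmxA.
suff -> : dotp ((y 0 0 *: v) *m A) (z *m (B' *m C)) = 0 by rewrite mulr0 addr0.
rewrite -scalemxAl dotpZl dotp_mull sA dotpC /dotp -mulmxA.
have : (z *m (B' *m C) <= K)%MS.
  by rewrite (submx_trans (submxMl _ _)) // (submx_trans B'K) // diffmxSl.
by move/sub_kermxP ->; rewrite [X in _ * X]mxE mulr0.
Qed.

(** A subspace is closed under differences, and a quotient of two values in [a] times the squares is
    a square, so a nonsquare ratio never occurs. *)
Lemma ratio_avoiding_subspace (F : finFieldType) (d : nat) (A : 'M[F]_d) :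
  odd #|F| -> nondeg A ->
  exists (E : {set 'rV[F]_d}) (r : F),
    #|E| = (#|F| ^ (d.+1)./2)%N /\ r != 0 /\ Wcount A E r = 0%N.
Proof.
move=> oddF /nondegP[sA _].
have [B fB [a ha]] := rank_one_subspace_exists oddF sA.
have [r rn] := nonsquare_exists oddF.
have r0 : r != 0 by apply/eqP=> r0; apply: rn; exists 0; rewrite expr0n.
exists [set x *m B | x : 'rV[F]_((d.+1)./2)], r; split; last split=> //.
  by rewrite card_imset ?card_mx ?mul1n //; apply: row_free_inj.
apply/eqP; rewrite cards_eq0; apply/eqP/setP=> -[[[x y] z] w]; rewrite !inE /=.
apply/negP=> /and5P[/imsetP[x' _ ->] /imsetP[y' _ ->] /imsetP[z' _ ->]].
move=> /imsetP[w' _ ->]; rewrite -!mulmxBl.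
have [k ->] := ha (x' - y'); have [l ->] := ha (z' - w').
case/andP; rewrite mulf_eq0 negb_or => /andP[a0 l0] /eqP rE; apply: rn.
exists (k / l); rewrite -rE expr_div_n.
by rewrite -mulf_div divff // mul1r.
Qed.

(** * Points over a subfield of index two in characteristic 3 *)

Section QuadraticSubfield.
Variables (F : finFieldType) (k : nat).
Notation P := (3 ^ k)%N.
Hypothesis k0 : (0 < k)%N.
Hypothesis char3 : 3%N \in [pchar F].
Hypothesis cardF : #|F| = (P * P)%N.

Definition subfield3 : {set F} := [set x | x ^+ P == x].

Lemma pow3_gt1 : (1 < P)%N.
Proof. by rewrite -{1}(expn0 3) ltn_exp2l. Qed.

Lemma frobeniusD (x y : F) : (x + y) ^+ P = x ^+ P + y ^+ P.
Proof. by rewrite exprDn_pchar // pnatX (eq_pnat _ (pcharf_eq char3)) pnat_id. Qed.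

Lemma frobeniusN (x : F) : (- x) ^+ P = - x ^+ P.
Proof. by rewrite exprNn -signr_odd oddX orbT expr1 mulN1r. Qed.

Lemma card_roots_trinomial (c : F) : (#|[set x : F | (x ^+ P == c * x)%R]| <= P)%N.
Proof.
pose p : {poly F} := 'X^P - c *: 'X.
have sp : size p = P.+1.
  rewrite size_polyDl size_polyXn // size_polyN ltnS.
  by rewrite (leq_trans (size_scale_leq _ _)) // size_polyX pow3_gt1.
have p0 : p != 0 by rewrite -size_poly_eq0 sp.
have := @max_poly_roots F p (enum [set x : F | x ^+ P == c * x]) p0.
rewrite sp ltnS -cardE; apply; last exact: enum_uniq.
by apply/allP=> x; rewrite mem_enum inE /root !hornerE subr_eq0.
Qed.

(** The additive map sending [x] to [x ^+ P - x] has kernel [subfield3], and its image lies among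
    the at most [P] roots of [x ^+ P = - x]; the field has [P * P] elements. *)
Lemma card_subfield3_ge : (P <= #|subfield3|)%N.
Proof.
pose f (x : F) := x ^+ P - x.
have fB x y : f (x - y) = f x - f y by rewrite /f frobeniusD frobeniusN; ring.
have imf : (#|[set f x | x in [set: F]]| <= P)%N.
  apply: leq_trans (card_roots_trinomial (-1)); apply: subset_leq_card.
  apply/subsetP=> _ /imsetP[x _ ->]; rewrite inE /f frobeniusD frobeniusN.
  by rewrite -exprM -cardF expf_card mulN1r opprB.
have : (#|F| <= #|[set f x | x in [set: F]]| * #|subfield3|)%N.
  rewrite -cardsT -sum1_card (partition_big_imset f) /= -sum_nat_const.
  apply: leq_sum => _ /imsetP[x0 _ ->].
  rewrite sum1dep_card -(card_imset _ (addIr (- x0))); apply: subset_leq_card.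
  apply/subsetP=> y /imsetP[x]; rewrite !inE /= => /eqP fx ->.
  by rewrite -subr_eq0 -/(f _) fB fx subrr.
rewrite cardF => h.
rewrite -(leq_pmul2l (ltnW pow3_gt1)); apply: leq_trans h _.
by rewrite leq_mul2r imf orbT.
Qed.

Lemma two_subfield3_mul (x : F) : (2%:R * x) ^+ P = 2%:R * x -> x ^+ P = x.
Proof.
move=> h; have -> : x = - (2%:R * x).
  apply/eqP; rewrite -subr_eq0 opprK; apply/eqP.
  have -> : x + 2%:R * x = 3%:R * x by ring.
  by move: char3; rewrite inE /= => /eqP ->; rewrite mul0r.
by rewrite frobeniusN h.
Qed.

(** Were all squares fixed by Frobenius, so would be 2 x = (x + 1)^2 - x^2 - 1, hence every [x] in
    characteristic 3: too many roots. *)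
Lemma square_outside_subfield3 : exists s : F, s ^+ 2 \notin subfield3.
Proof.
apply/existsP; rewrite -[[exists _, _]]negbK negb_exists; apply/negP.
move=> /forallP all; have sqP (s : F) : (s ^+ 2) ^+ P = s ^+ 2.
  by apply/eqP; have := all s; rewrite negbK inE.
have full : [set x : F | x ^+ P == 1 * x] = setT.
  apply/setP=> x; rewrite !inE mul1r; apply/eqP/two_subfield3_mul.
  have -> : 2%:R * x = (x + 1) ^+ 2 + - x ^+ 2 + - 1 ^+ 2 by ring.
  by rewrite !frobeniusD !frobeniusN !sqP.
have := card_roots_trinomial 1; rewrite full cardsT cardF.
by rewrite leqNgt -{1}[P]muln1 ltn_pmul2l ?pow3_gt1 // (ltnW pow3_gt1).
Qed.

(** The standard form takes values in the subfield at differences of subfield points, so all ratios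
    lie there, whereas [r] is a square of [F] outside it. *)
Lemma subfield_avoids_ratio (d : nat) :
  exists (E : {set 'rV[F]_d}) (r : F),
    [/\ (P ^ d <= #|E|)%N, is_nz_square r & Wcount 1%:M E r = 0%N].
Proof.
have [s sn] := square_outside_subfield3.
exists [set x : 'rV[F]_d | [forall i, x 0 i \in subfield3]], (s ^+ 2); split.
- apply: (@leq_trans (#|subfield3| ^ d)%N).
    by case: (d) => [|d'] //; rewrite leq_exp2r // card_subfield3_ge.
  have := card_ffun_on 'I_d (mem subfield3); rewrite card_ord => <-.
  pose g (f : {ffun 'I_d -> F}) := \row_i f i.
  have ginj : injective g.
    by move=> f1 f2 /rowP h; apply/ffunP=> i; have := h i; rewrite !mxE.
  rewrite -(card_imset _ ginj); apply: subset_leq_card.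
  apply/subsetP=> _ /imsetP[f /ffun_onP fK ->]; rewrite inE.
  by apply/forallP=> i; rewrite mxE fK.
- split; last by exists s.
  by apply: contraNneq sn => ->; rewrite inE expr0n expn_eq0.
have Q (x y : 'rV[F]_d) : [forall i, x 0 i \in subfield3] ->
    [forall i, y 0 i \in subfield3] ->
    qform (1%:M : 'M[F]_d) (x - y) ^+ P = qform 1%:M (x - y).
  move=> /forallP xK /forallP yK.
  have P0 : 0 ^+ P = 0 :> F by rewrite expr0n expn_eq0.
  rewrite /qform (big_morph _ frobeniusD P0); apply: eq_bigr => i _.
  rewrite (big_morph _ frobeniusD P0); apply: eq_bigr => j _.
  rewrite !mxE !exprMn !frobeniusD !frobeniusN.
  have := xK i; have := xK j; have := yK i; have := yK j; rewrite !inE.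
  move=> /eqP -> /eqP -> /eqP -> /eqP ->.
  by case: (i == j); rewrite ?expr1n ?P0.
apply/eqP; rewrite cards_eq0; apply/eqP/setP=> -[[[x y] z] w]; rewrite !inE /=.
apply/negP=> /and5P[hx hy hz hw /andP[_ /eqP rE]].
by case/negP: sn; rewrite inE -rE expr_div_n !Q.
Qed.

End QuadraticSubfield.

(** * Choice of the field order for (ii), and assembly *)

Lemma INR_expn (m k : nat) : INR (m ^ k) = pow (INR m) k.
Proof. by elim: k => //= k IH; rewrite expnS mult_INR IH. Qed.

(** Taking logarithms, the claim reads ln C <= k (d - 2 g) ln 3, which holds for large [k]. *)
Lemma power_gap (d : nat) (g C : R) : Rlt g (Rdiv (INR d) 2) -> Rlt 0 C ->
  exists2 k : nat, (0 < k)%N &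
  Rle (Rmult C (Rpower (INR (3 ^ k * 3 ^ k)) g)) (INR ((3 ^ k) ^ d)).
Proof.
move=> hg C0.
pose e := Rmult (Rminus (INR d) (Rmult 2 g)) (ln 3).
have ln3 : Rlt 0 (ln 3) by rewrite -ln_1; apply: ln_increasing; Lra.lra.
have e0 : Rlt 0 e by apply: Rmult_lt_0_compat => //; Lra.lra.
have [k hk] : exists k : nat, Rlt (Rdiv (ln C) e) (INR k).
  exact: INR_unbounded.
(* The successor guarantees positivity. *)
exists k.+1 => //.
have T0 : Rlt 0 (INR (3 ^ k.+1)).
  by rewrite INR_expn; apply: pow_lt; rewrite /=; Lra.lra.
have lnT : ln (INR (3 ^ k.+1)) = Rmult (INR k.+1) (ln 3).
  rewrite INR_expn -Rpower_pow; last by rewrite /=; Lra.lra.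
  by rewrite /Rpower ln_exp; congr (Rmult _ (ln _)); rewrite /=; Lra.lra.
rewrite mult_INR [X in Rle _ X]INR_expn -Rpower_pow // /Rpower ln_mult // lnT.
rewrite -{1}(exp_ln C) // -exp_plus.
pose l := Rmult (INR k.+1) (ln 3).
suff : Rle (Rplus (ln C) (Rmult g (Rplus l l))) (Rmult (INR d) l).
  case=> [h|->]; last exact: Rle_refl.
  by left; apply: exp_increasing.
have : Rle (ln C) (Rmult (INR k.+1) e).
  have -> : ln C = Rmult (Rdiv (ln C) e) e.
    by rewrite /Rdiv Rmult_assoc Rinv_l ?Rmult_1_r; Lra.lra.
  apply: Rmult_le_compat_r; first by left.
  rewrite S_INR; Lra.lra.
rewrite /e /l; Lra.lra.
Qed.

Theorem theorem1p6 :
  (* (i) lower bound, d even *)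
  (forall (F : finFieldType) (d : nat) (A : 'M[F]_d) (E : {set 'rV[F]_d}),
     odd #|F| -> (2 <= d)%N -> ~~ odd d -> nondeg A ->
     (4 * #|F| ^ d./2 <= #|E|)%N ->
     forall r : F, r != 0 -> (5 * #|E| ^ 4 <= 48 * #|F| * Wcount A E r)%N)
  /\
  (* (i) sharpness *)
  (forall (F : finFieldType) (d : nat) (A : 'M[F]_d),
     odd #|F| -> (2 <= d)%N -> ~~ odd d -> nondeg A ->
     exists (E : {set 'rV[F]_d}) (r : F),
       #|E| = (#|F| ^ d./2)%N /\ r != 0 /\ Wcount A E r = 0%N)
  /\
  (* (ii) lower bound, d odd, r a nonzero square; |E| >= 3 q^(d/2) <-> |E|^2 >= 9 q^d *)
  (forall (F : finFieldType) (d : nat) (A : 'M[F]_d) (E : {set 'rV[F]_d}),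
     odd #|F| -> (2 <= d)%N -> odd d -> nondeg A ->
     (9 * #|F| ^ d <= #|E| ^ 2)%N ->
     forall r : F, is_nz_square r -> (2 * #|E| ^ 4 <= 45 * #|F| * Wcount A E r)%N)
  /\
  (* (ii) the exponent d/2 cannot be lowered *)
  (forall (d : nat), (3 <= d)%N -> odd d ->
     forall (g C : R), Rlt g (Rdiv (INR d) 2) -> Rlt 0 C ->
     exists (F : finFieldType) (A : 'M[F]_d) (E : {set 'rV[F]_d}) (r : F),
       [/\ odd #|F|, nondeg A,
           Rle (Rmult C (Rpower (INR #|F|) g)) (INR #|E|),
           is_nz_square r & Wcount A E r = 0%N])
  /\
  (* (iii) lower bound, d odd, all r <> 0 *)
  (forall (F : finFieldType) (d : nat) (A : 'M[F]_d) (E : {set 'rV[F]_d}),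
     odd #|F| -> (2 <= d)%N -> odd d -> nondeg A ->
     (11 * #|F| ^ (d.+1)./2 <= 6 * #|E|)%N ->
     forall r : F, r != 0 -> (2 * #|E| ^ 4 <= 363 * #|F| * Wcount A E r)%N)
  /\
  (* (iii) sharpness *)
  (forall (F : finFieldType) (d : nat) (A : 'M[F]_d),
     odd #|F| -> (3 <= d)%N -> odd d -> nondeg A ->
     exists (E : {set 'rV[F]_d}) (r : F),
       #|E| = (#|F| ^ (d.+1)./2)%N /\ r != 0 /\ Wcount A E r = 0%N).
Proof.
split=> [F d A E oddF _ ed nA|]; first exact: even_lower_bound.
split=> [F d A oddF _ ed nA|].
  (* For even [d] the two halves agree, so one construction serves both (i) and (iii). *)
  have -> : d./2 = (d.+1)./2 by rewrite -uphalfE uphalf_half (negbTE ed).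
  exact: ratio_avoiding_subspace.
split=> [F d A E oddF _ od nA|]; first exact: odd_square_lower_bound.
split=> [d _ _ g C hg C0|].
  have [k k0 hk] := power_gap hg C0.
  have kk0 : (0 < k + k)%N by rewrite addn_gt0 k0.
  have [F char3 cF] := pPrimePowerField (isT : prime 3) kk0.
  have cardF : #|F| = (3 ^ k * 3 ^ k)%N by rewrite cF expnD.
  have [E [r [hE rs W0]]] := subfield_avoids_ratio k0 char3 cardF d.
  exists F, 1%:M, E, r; split=> //.
  - by rewrite cF oddX orbT.
  - by apply/nondegP; rewrite trmx1 unitmx1.
  - rewrite cardF; apply: Rle_trans hk _; apply: le_INR; exact/ssrnat.leP.
split=> [F d A E oddF _ od nA|F d A oddF _ _ nA]; first exact: odd_lower_bound.
exact: ratio_avoiding_subspace.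
Qed.
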